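(* Let $y>-1$ and $\alpha\in(-\infty,\infty)$ be real numbers, and let $h_{\alpha,y}:(-y-1,\infty)\to(0,\infty)$ be the function $$ h_{\alpha,y}(x)= \begin{cases} \dfrac1{(x+y+1)^\alpha}\biggl[\dfrac{\Gamma(x+y+1)}{\Gamma(y+1)}\biggr]^{1/x}, & x\in(-y-1,\infty)\setminus\{0\},\\ \dfrac1{(y+1)^\alpha}\exp[\psi(y+1)], & x=0. \end{cases} $$ Then the following statements hold: (1) the function $h_{\alpha,y}$ is logarithmically completely monotonic with respect to $x\in(-y-1,\infty)$ if and only if $\alpha\ge\max\bigl\{1,\frac1{y+1}\bigr\}$; (2) if $\alpha\le\min\bigl\{1,\frac1{2(y+1)}\bigr\}$, then the reciprocal $1/h_{\alpha,y}$ is logarithmically completely monotonic with respect to $x\in(-y-1,\infty)$; (3) if the reciprocal $1/h_{\alpha,y}$ is logarithmically completely monotonic with respect to $x\in(-y-1,\infty)$, then $\alpha\le1$.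
   Context: $\Gamma$ is the classical Euler gamma function and $\psi(x)=\Gamma'(x)/\Gamma(x)$ is the digamma function, for $x>0$. A positive real-valued function $f$ is said to be logarithmically completely monotonic on an interval $I\subseteq\mathbb{R}$ if it has derivatives of all orders on $I$ and $0\le(-1)^k[\ln f(x)]^{(k)}<\infty$ for all $k\in\mathbb{N}=\{1,2,3,\dots\}$ and all $x\in I$. *)

(* Defs.v *)
(* Stdlib reals with Coquelicot. *)
From Stdlib Require Export Reals.
From Coquelicot Require Export Coquelicot.
Open Scope R_scope.

(* Euler's integral of the second kind; meaningful for [0 < x]. *)
Definition Gamma (x : R) : R :=
  RInt_gen (fun t : R => Rpower t (x - 1) * exp (- t))
           (at_right 0) (Rbar_locally p_infty).

Definition digamma (x : R) : R := Derive Gamma x / Gamma x.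

(* On the open interval (a, b), possibly unbounded. As the interval is open,
   [Derive_n] at its points depends only on the values of [f] inside it.
   [ex_derive_n] of [ln f] expresses that the k-th derivative of [ln f] exists
   and is finite, so that [Derive_n] is not a default value. *)
Definition log_completely_monotonic (a b : Rbar) (f : R -> R) : Prop :=
  (forall x : R, Rbar_lt a x -> Rbar_lt x b -> 0 < f x) /\
  (forall (k : nat) (x : R),
     Rbar_lt a x -> Rbar_lt x b -> ex_derive_n f k x) /\
  (forall (k : nat) (x : R),
     (1 <= k)%nat -> Rbar_lt a x -> Rbar_lt x b ->
     ex_derive_n (fun t : R => ln (f t)) k x /\
     0 <= (-1) ^ k * Derive_n (fun t : R => ln (f t)) k x).

(* Only the values for [-1 < y] and [- y - 1 < x] are meaningful. *)
Definition h (alpha y x : R) : R :=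
  if Req_EM_T x 0 then
    1 / Rpower (y + 1) alpha * exp (digamma (y + 1))
  else
    1 / Rpower (x + y + 1) alpha *
    Rpower (Gamma (x + y + 1) / Gamma (y + 1)) (1 / x).

(* Main.v *)
Require Import Defs.
From Stdlib Require Import Reals Factorial Lra Lia Classical.
From Coquelicot Require Import Coquelicot.
Open Scope R_scope.

(** Write [a = y + 1], [X = x + a] and [z = a + x s], so that [z > 0] for all
    [s] in [[0, 1]] as soon as [a > 0] and [X > 0]. Both cases of the
    definition of [h] are covered by one formula, smooth across [x = 0]:
      ln h (x) = int_0^1 digamma (a + x s) ds - alpha ln X.
    Differentiating [k >= 1] times under the integral sign, and using
      digamma^(k) (z) = (-1)^(k+1) k! zeta (k+1, z)
    with the Hurwitz zeta function, gives
      (-1)^k (ln h)^(k) (x)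
        = k! (alpha / (k X^k) - int_0^1 s^k zeta (k+1, z) ds).
    The point is that the first term is also an integral against [s^k]:
      1 / (k X^k) = int_0^1 s^k (1 / (k z^k) + a / z^(k+1)) ds,
    because [s^(k+1) / (k z^k)] is a primitive of the integrand. Sufficiency in
    (1) and (2) therefore follows pointwise in [s] from
      1 / (k z^k) + 1 / (2 z^(k+1)) <= zeta (k+1, z) <= 1 / (k z^k) + 1 / z^(k+1),
    which is proved by telescoping ([hurwitz_bounds]).

    The necessary conditions use only [k = 1]. Crude bounds on [zeta (2, z)]
    turn the sign of [(ln h)'] into inequalities between [alpha] and
    [X L (x)], where [L (x) = int_0^1 s / z ds] is elementary. As [X] tends to
    infinity [X L] tends to [1], which yields [alpha >= 1] in (1) and
    [alpha <= 1] in (3); as [X] tends to [0], [X L] tends to [0], which yields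
    [alpha a >= 1] in (1).

    The series for the derivatives of the digamma function come from an
    argument of Bohr-Mollerup type ([is_derive_ln_Gamma_digamma]). Integrating
    [zeta (2, .)] twice produces a function [g] with [g (x+1) - g x = ln x].
    The functional equation of [Gamma] makes [ln Gamma - g] periodic, and
    Wendel's inequality [Gamma (x+s) <= x^s Gamma x] makes its increments over
    intervals of length at most [1] tend to [0] at infinity. Hence it is
    constant, without any differentiation of Euler's integral. *)

(** * The Hurwitz zeta function at integers *)

Definition hurwitz (s : nat) (x : R) : R :=
  Series (fun n => / (x + INR n) ^ s).

Lemma shift_pos (x : R) (n : nat) : 0 < x -> 0 < x + INR n.
Proof. intros hx. pose proof (pos_INR n). lra. Qed.

(** With [p = 1 / x] and [q = 1 / (x + 1)], whose characteristic property is
    [p - q = p q], this bounds [int_x^(x+1) k t^(-k-1) dt] from below by the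
    value of its integrand at the right end. *)
Lemma pow_sub_lower (p q : R) (k : nat) :
  0 < q <= p -> p - q = p * q -> INR k * q ^ S k <= p ^ k - q ^ k.
Proof.
  intros hq hpq. induction k as [|k IH].
  - simpl. lra.
  - assert (E : p ^ S k - q ^ S k = p * (p ^ k - q ^ k) + p * q * q ^ k)
      by (rewrite <- hpq; simpl; ring).
    rewrite E, S_INR.
    assert (Hk : 0 < q ^ S k) by (apply pow_lt; lra).
    assert (0 <= INR k * q ^ S k) by (apply Rmult_le_pos; [apply pos_INR | lra]).
    assert (q * (INR k * q ^ S k) <= p * (p ^ k - q ^ k))
      by (apply Rmult_le_compat; lra).
    assert (q * q ^ S k <= p * q ^ S k) by (apply Rmult_le_compat_r; lra).
    replace (q ^ S (S k)) with (q * q ^ S k) by (simpl; ring).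
    replace (p * q * q ^ k) with (p * q ^ S k) by (simpl; ring).
    lra.
Qed.

(** The trapezoidal rule overestimates the integral of the convex function
    [t^(-k-1)] over [[x, x + 1]]; here [p] and [q] are as in [pow_sub_lower]. *)
Lemma pow_sub_upper (p q : R) (k : nat) :
  0 < q <= p -> p - q = p * q ->
  2 * (p ^ k - q ^ k) <= INR k * (p ^ S k + q ^ S k).
Proof.
  intros hq hpq. induction k as [|k IH].
  - simpl. lra.
  (* Average the two ways of splitting a difference of powers, to keep the
     symmetry between [p] and [q]. *)
  - assert (E : 2 * (p ^ S k - q ^ S k)
                = (p + q) * (p ^ k - q ^ k) + (p - q) * (p ^ k + q ^ k))
      by (simpl; ring).
    rewrite hpq in E.
    assert (C : 0 <= (p - q) * (p ^ S k - q ^ S k)).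
    { apply Rmult_le_pos; [lra|].
      assert (q ^ S k <= p ^ S k) by (apply pow_incr; lra). lra. }
    rewrite E, S_INR.
    assert (D : (p + q) * (2 * (p ^ k - q ^ k))
                <= (p + q) * (INR k * (p ^ S k + q ^ S k)))
      by (apply Rmult_le_compat_l; lra).
    assert (G : 0 <= INR k * ((p - q) * (p ^ S k - q ^ S k)))
      by (apply Rmult_le_pos; [apply pos_INR | lra]).
    simpl in *. nra.
Qed.

Lemma is_series_telescope (u : nat -> R) :
  is_lim_seq u 0 -> is_series (fun n => u n - u (S n)) (u 0%nat).
Proof.
  intros hu. unfold is_series.
  apply (filterlim_ext (fun n => u 0%nat - u (S n))).
  - intros n. induction n as [|n IH].
    + rewrite sum_O. reflexivity.
    + rewrite sum_Sn, <- IH. unfold plus; simpl. ring.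
  - change (is_lim_seq (fun n => u 0%nat - u (S n)) (u 0%nat)).
    replace (Finite (u 0%nat)) with (Finite (u 0%nat - 0)) by (f_equal; ring).
    apply is_lim_seq_minus'; [apply is_lim_seq_const|].
    now apply is_lim_seq_incr_1 in hu.
Qed.

Lemma is_lim_seq_inv_shift_pow (x : R) (k : nat) :
  0 < x -> is_lim_seq (fun n => / (x + INR n) ^ S k) 0.
Proof.
  intros hx.
  assert (L : is_lim_seq (fun n => x + INR n) p_infty).
  { apply (is_lim_seq_le_p_loc INR); [|apply is_lim_seq_INR].
    exists 0%nat. intros n _. lra. }
  assert (L1 : is_lim_seq (fun n => / (x + INR n)) 0).
  { replace (Finite 0) with (Rbar_inv p_infty) by reflexivity.
    apply is_lim_seq_inv; [exact L | discriminate]. }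
  induction k as [|k IH].
  - eapply is_lim_seq_ext; [|exact L1]. intros n. simpl. now rewrite Rmult_1_r.
  - eapply is_lim_seq_ext; [|replace (Finite 0) with (Finite (0 * 0)) by (f_equal; ring);
      exact (is_lim_seq_mult' _ _ _ _ L1 IH)].
    intros n. simpl. pose proof (shift_pos x n hx).
    assert (0 < (x + INR n) ^ k) by now apply pow_lt.
    field. lra.
Qed.

(** The integral of [t^(-k-1)] over [[x, oo)] plus [c] times the value at [x]: the
    Riemann sum [hurwitz (S k) x] of this integral is compared with it for
    [c = 1/2], the trapezoidal rule, and for [c = 1]. *)
Definition power_tail (c : R) (k : nat) (x : R) : R :=
  / (INR k * x ^ k) + c / x ^ S k.

Lemma is_series_power_tail (c : R) (k : nat) (x : R) :
  (1 <= k)%nat -> 0 < x ->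
  is_series (fun n => power_tail c k (x + INR n) - power_tail c k (x + INR n + 1))
            (power_tail c k x).
Proof.
  intros hk hx.
  replace (power_tail c k x) with (power_tail c k (x + INR 0))
    by (f_equal; simpl; ring).
  eapply is_series_ext; [|apply (is_series_telescope (fun n => power_tail c k (x + INR n)))].
  - intros n. cbv beta. rewrite S_INR. now rewrite Rplus_assoc.
  - unfold power_tail. destruct k as [|k]; [lia|].
    replace (Finite 0) with (Finite (/ INR (S k) * 0 + c * 0)) by (f_equal; ring).
    apply is_lim_seq_plus'.
    + eapply is_lim_seq_ext;
        [|apply (is_lim_seq_scal_l (fun n => / (x + INR n) ^ S k) (/ INR (S k)) 0);
          now apply is_lim_seq_inv_shift_pow].
      intros n. cbv beta. now rewrite Rinv_mult.
    + apply (is_lim_seq_scal_l (fun n => / (x + INR n) ^ S (S k)) c 0).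
      now apply is_lim_seq_inv_shift_pow.
Qed.

(** The general term of the Hurwitz series lies between the differences of two
    telescoping sequences, which is what makes [hurwitz_bounds] a comparison of
    series. *)
Lemma power_tail_step (k : nat) (x : R) :
  (1 <= k)%nat -> 0 < x ->
  0 <= power_tail (1/2) k x - power_tail (1/2) k (x + 1) <= / x ^ S k /\
  / x ^ S k <= power_tail 1 k x - power_tail 1 k (x + 1).
Proof.
  intros hk hx.
  assert (hk' : 0 < INR k) by (apply lt_0_INR; lia).
  set (p := / x). set (q := / (x + 1)).
  assert (hq : 0 < q) by (apply Rinv_0_lt_compat; lra).
  assert (hqp : q <= p) by (apply Rinv_le_contravar; lra).
  assert (hpq : p - q = p * q) by (unfold p, q; field; lra).
  pose proof (pow_sub_lower p q k (conj hq hqp) hpq) as A.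
  pose proof (pow_sub_upper p q k (conj hq hqp) hpq) as B.
  assert (E : forall c, power_tail c k x - power_tail c k (x + 1)
    = (p ^ k - q ^ k) / INR k + c * (p ^ S k - q ^ S k)).
  { intros c. unfold power_tail, p, q. rewrite !pow_inv.
    assert (0 < x ^ k) by now apply pow_lt.
    assert (0 < (x + 1) ^ k) by (apply pow_lt; lra).
    simpl. field. lra. }
  rewrite !E. replace (/ x ^ S k) with (p ^ S k) by (unfold p; apply pow_inv).
  assert (hi : 0 < / INR k) by now apply Rinv_0_lt_compat.
  assert (A' : q ^ S k <= (p ^ k - q ^ k) / INR k)
    by (apply (proj1 (Rle_div_r _ _ _ hk')); rewrite Rmult_comm; exact A).
  assert (B' : (p ^ k - q ^ k) / INR k <= (p ^ S k + q ^ S k) / 2)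
    by (apply (proj2 (Rle_div_l _ _ _ hk')); lra).
  assert (q ^ S k <= p ^ S k) by (apply pow_incr; lra).
  assert (0 < q ^ S k) by now apply pow_lt.
  lra.
Qed.

Lemma inv_shift_pow_pos (s : nat) (x : R) (n : nat) :
  0 < x -> 0 < / (x + INR n) ^ s.
Proof.
  intros hx. apply Rinv_0_lt_compat, pow_lt. now apply shift_pos.
Qed.

Lemma ex_series_hurwitz (k : nat) (x : R) :
  (1 <= k)%nat -> 0 < x -> ex_series (fun n => / (x + INR n) ^ S k).
Proof.
  intros hk hx.
  apply (@ex_series_le R_AbsRing R_CompleteNormedModule _ (fun n =>
    power_tail 1 k (x + INR n) - power_tail 1 k (x + INR n + 1))).
  - intros n. unfold norm; simpl. unfold abs; simpl.
    rewrite Rabs_right by (apply Rle_ge, Rlt_le, (inv_shift_pow_pos (S k)); assumption).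
    apply (power_tail_step k (x + INR n) hk). now apply shift_pos.
  - eexists. now apply is_series_power_tail.
Qed.

Lemma hurwitz_bounds (k : nat) (x : R) :
  (1 <= k)%nat -> 0 < x ->
  power_tail (1/2) k x <= hurwitz (S k) x <= power_tail 1 k x.
Proof.
  intros hk hx. unfold hurwitz. split.
  - rewrite <- (is_series_unique _ _ (is_series_power_tail (1/2) k x hk hx)).
    apply Series_le; [|now apply ex_series_hurwitz].
    intros n. apply (power_tail_step k (x + INR n) hk). now apply shift_pos.
  - rewrite <- (is_series_unique _ _ (is_series_power_tail 1 k x hk hx)).
    apply Series_le.
    + intros n. split.
      * apply Rlt_le, (inv_shift_pow_pos (S k)), hx.
      * apply (power_tail_step k (x + INR n) hk). now apply shift_pos.
    + eexists. now apply is_series_power_tail.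
Qed.

Lemma hurwitz_shift (k : nat) (x : R) :
  (1 <= k)%nat -> 0 < x -> hurwitz (S k) x = / x ^ S k + hurwitz (S k) (x + 1).
Proof.
  intros hk hx. unfold hurwitz.
  rewrite Series_incr_1 by now apply ex_series_hurwitz.
  f_equal.
  - now rewrite Rplus_0_r.
  - apply Series_ext. intros n. rewrite S_INR. do 2 f_equal. ring.
Qed.

(** The remainder of the series is again a Hurwitz zeta value, at a point that
    tends to infinity uniformly in [x > 0]; uniform convergence then needs only
    the decay bound [hurwitz_le_2_div]. *)
Lemma hurwitz_partial (k N : nat) (x : R) :
  (1 <= k)%nat -> 0 < x ->
  hurwitz (S k) x
  = sum_n (fun n => / (x + INR n) ^ S k) N + hurwitz (S k) (x + INR (S N)).
Proof.
  intros hk hx. unfold hurwitz.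
  rewrite (Series_incr_n _ (S N)) by (try lia; now apply ex_series_hurwitz).
  rewrite sum_n_Reals. cbn [pred Nat.pred]. f_equal.
  apply Series_ext. intros n. rewrite plus_INR. do 2 f_equal. ring.
Qed.

Lemma hurwitz_limit (k : nat) (x : R) :
  Lim_seq (fun N => sum_n (fun n => / (x + INR n) ^ S k) N) = hurwitz (S k) x :> R.
Proof. reflexivity. Qed.

Lemma hurwitz_le_2_div (k : nat) (x : R) :
  (1 <= k)%nat -> 1 <= x -> hurwitz (S k) x <= 2 / x.
Proof.
  intros hk hx. destruct k as [|k]; [lia|].
  eapply Rle_trans; [apply hurwitz_bounds; [lia|lra]|].
  unfold power_tail, Rdiv. rewrite Rinv_mult.
  assert (hi : / x ^ S k <= / x).
  { apply Rinv_le_contravar; [lra|]. rewrite <- (pow_1 x) at 1.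
    apply Rle_pow; [lra|lia]. }
  assert (hi2 : / x ^ S (S k) <= / x).
  { apply Rinv_le_contravar; [lra|]. rewrite <- (pow_1 x) at 1.
    apply Rle_pow; [lra|lia]. }
  assert (0 < / INR (S k) <= 1).
  { split; [apply Rinv_0_lt_compat, lt_0_INR; lia|].
    rewrite <- Rinv_1. apply Rinv_le_contravar; [lra|].
    rewrite S_INR. pose proof (pos_INR k). lra. }
  assert (0 < / x ^ S k) by (apply Rinv_0_lt_compat, pow_lt; lra).
  nra.
Qed.

Lemma CVU_hurwitz (k : nat) :
  (1 <= k)%nat ->
  CVU_dom (fun N x => sum_n (fun n => / (x + INR n) ^ S k) N) (fun x => 0 < x).
Proof.
  intros hk eps.
  destruct (nfloor_ex (2 / eps)) as [N0 HN0].
  { apply Rlt_le, Rdiv_lt_0_compat; [lra|apply cond_pos]. }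
  exists N0. intros N HN x hx.
  rewrite hurwitz_limit, (hurwitz_partial k N x hk hx).
  set (s := sum_n _ N).
  replace (s - _) with (- hurwitz (S k) (x + INR (S N))) by ring.
  assert (hN : INR N0 <= INR N) by now apply le_INR.
  assert (hpos : 1 <= x + INR (S N)) by (rewrite S_INR; pose proof (pos_INR N); lra).
  rewrite Rabs_Ropp, Rabs_right.
  - eapply Rle_lt_trans; [apply hurwitz_le_2_div; assumption|].
    pose proof (cond_pos eps) as he.
    apply Rlt_div_l; [lra|].
    destruct HN0 as [_ HN0]. apply Rlt_div_l in HN0; [|exact he].
    rewrite S_INR in *. nra.
  - apply Rle_ge. eapply Rle_trans; [|apply hurwitz_bounds; [assumption|lra]].
    unfold power_tail.
    assert (0 < INR k) by (apply lt_0_INR; lia).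
    assert (0 < (x + INR (S N)) ^ k) by (apply pow_lt; lra).
    assert (0 < (x + INR (S N)) ^ S k) by (apply pow_lt; lra).
    apply Rplus_le_le_0_compat.
    + apply Rlt_le, Rinv_0_lt_compat. now apply Rmult_lt_0_compat.
    + apply Rlt_le, Rdiv_lt_0_compat; lra.
Qed.

Lemma is_derive_inv_shift_pow (s n : nat) (x : R) :
  0 < x ->
  is_derive (fun x => / (x + INR n) ^ s) x (- INR s * / (x + INR n) ^ S s).
Proof.
  intros hx. pose proof (shift_pos x n hx) as hp.
  assert (0 < (x + INR n) ^ s) by now apply pow_lt.
  auto_derive; [lra|].
  destruct s as [|s].
  - simpl. field. lra.
  - cbn [Nat.pred pred]. assert (0 < (x + INR n) ^ s) by now apply pow_lt.
    simpl (_ ^ S _). field. lra.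
Qed.

(** Term-by-term differentiation: the differentiated series is a multiple of
    another Hurwitz series, so [CVU_hurwitz] controls both. *)
Lemma is_derive_hurwitz (k : nat) (x : R) :
  (1 <= k)%nat -> 0 < x ->
  is_derive (hurwitz (S k)) x (- INR (S k) * hurwitz (S (S k)) x).
Proof.
  intros hk hx.
  set (fn := fun N x => sum_n (fun n => / (x + INR n) ^ S k) N).
  set (dfn := fun N x => - INR (S k) * sum_n (fun n => / (x + INR n) ^ S (S k)) N).
  assert (hd : forall N z, 0 < z -> is_derive (fn N) z (dfn N z)).
  { intros N z hz. unfold fn, dfn.
    change (- INR (S k) * sum_n (fun n => / (z + INR n) ^ S (S k)) N)
      with (mult (- INR (S k)) (sum_n (fun n => / (z + INR n) ^ S (S k)) N)).
    rewrite <- (sum_n_mult_l (K := R_Ring)).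
    apply (is_derive_sum_n (fun n x => / (x + INR n) ^ S k)).
    intros n _. now apply is_derive_inv_shift_pow. }
  assert (hD : forall N z, 0 < z -> Derive (fn N) z = dfn N z)
    by (intros; now apply is_derive_unique, hd).
  assert (hlim : forall z, 0 < z ->
    Lim_seq (fun N => Derive (fn N) z) = - INR (S k) * hurwitz (S (S k)) z :> R).
  { intros z hz.
    rewrite (Lim_seq_ext _ (fun N => dfn N z)) by (intros; now apply hD).
    unfold dfn. rewrite Lim_seq_scal_l.
    pose proof (Series_correct _ (ex_series_hurwitz (S k) z ltac:(lia) hz)) as hs.
    change (is_lim_seq (sum_n (fun n => / (z + INR n) ^ S (S k)))
      (Series (fun n => / (z + INR n) ^ S (S k)))) in hs.
    apply is_lim_seq_unique in hs.
    change (Lim_seq (fun N => sum_n (fun n => / (z + INR n) ^ S (S k)) N)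
            = Finite (hurwitz (S (S k)) z)) in hs.
    replace (Lim_seq _) with (Finite (hurwitz (S (S k)) z)) by (symmetry; exact hs).
    reflexivity. }
  rewrite <- hlim by exact hx.
  apply (CVU_Derive fn (fun x => 0 < x)).
  - apply open_gt.
  - intros a b z ha hb hz. lra.
  - now apply CVU_hurwitz.
  - intros N z hz. eexists. now apply hd.
  - intros N z hz.
    apply (continuity_pt_ext_loc (dfn N)).
    + apply (filter_imp (fun t => 0 < t)); [|now apply (open_gt 0)].
      intros t ht. symmetry. now apply hD.
    + apply derivable_continuous_pt.
      apply ex_derive_Reals_0. unfold dfn. eexists.
      apply is_derive_scal.
      apply (is_derive_sum_n (fun n x => / (x + INR n) ^ S (S k))).
      intros n _. now apply is_derive_inv_shift_pow.
  - intros eps.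
    destruct (CVU_hurwitz (S k) ltac:(lia)
      (mkposreal (eps / INR (S k)) ltac:(apply Rdiv_lt_0_compat;
        [apply cond_pos|apply lt_0_INR; lia]))) as [N0 HN].
    exists N0. intros N hN z hz. rewrite hlim, hD by exact hz.
    specialize (HN N hN z hz). rewrite hurwitz_limit in HN. simpl pos in HN.
    unfold dfn. rewrite <- Rmult_minus_distr_l, Rabs_mult, Rabs_Ropp.
    assert (0 < INR (S k)) by (apply lt_0_INR; lia).
    rewrite (Rabs_right (INR (S k))) by lra.
    rewrite Rmult_comm. now apply (Rlt_div_r _ _ (INR (S k))).
  - exact hx.
Qed.

(** * Euler's integral *)

Definition Gamma_integrand (x t : R) : R := Rpower t (x - 1) * exp (- t).

Lemma Gamma_integrand_pos (x t : R) : 0 < Gamma_integrand x t.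
Proof. apply Rmult_lt_0_compat; apply exp_pos. Qed.

Lemma continuous_Gamma_integrand (x t : R) :
  0 < t -> continuous (Gamma_integrand x) t.
Proof.
  intros ht. apply (ex_derive_continuous (Gamma_integrand x)).
  unfold Gamma_integrand, Rpower. auto_derive. exact ht.
Qed.

Lemma ex_RInt_continuous_pos (f : R -> R) (a b : R) :
  (forall t, 0 < t -> continuous f t) -> 0 < a -> 0 < b -> ex_RInt f a b.
Proof.
  intros hf ha hb. apply (@ex_RInt_continuous R_CompleteNormedModule).
  intros t ht. apply hf.
  assert (0 < Rmin a b) by (apply Rmin_glb_lt; assumption). lra.
Qed.

Lemma filter_prod_ordered_pos (P : R * R -> Prop) :
  (forall a b, 0 < a -> a <= b -> P (a, b)) ->
  filter_prod (at_right 0) (Rbar_locally p_infty) P.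
Proof.
  intros hP.
  exists (fun a => 0 < a < 1) (fun b => 1 < b).
  - exists (mkposreal 1 Rlt_0_1). intros t ht h0. split; [exact h0|].
    apply Rabs_lt_between in ht. simpl in ht.
    unfold minus, plus, opp in ht; simpl in ht. lra.
  - now exists 1.
  - intros a b ha hb. apply hP; lra.
Qed.

(** Integrals of a nonnegative function over growing intervals increase, so they
    converge to their supremum when bounded. *)
Lemma ex_RInt_gen_bounded (f : R -> R) (M : R) :
  (forall t, 0 < t -> continuous f t) ->
  (forall t, 0 < t -> 0 <= f t) ->
  (forall a b, 0 < a -> a <= b -> RInt f a b <= M) ->
  exists l, is_RInt_gen f (at_right 0) (Rbar_locally p_infty) l /\
    forall a b, 0 < a -> a <= b -> RInt f a b <= l.
Proof.
  intros hc hp hM.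
  pose (E := fun v => exists a b, 0 < a /\ a <= b /\ v = RInt f a b).
  destruct (completeness E) as [l [hub hlub]].
  { exists M. intros v (a & b & ha & hab & ->). now apply hM. }
  { exists (RInt f 1 1), 1, 1. repeat split; lra. }
  assert (hl : forall a b, 0 < a -> a <= b -> RInt f a b <= l).
  { intros a b ha hab. apply hub. now exists a, b. }
  exists l. split; [|exact hl].
  intros P [eps hP].
  assert (hex : exists a0 b0, 0 < a0 /\ a0 <= b0 /\ l - eps < RInt f a0 b0).
  { destruct (classic (exists a0 b0, 0 < a0 /\ a0 <= b0 /\ l - eps < RInt f a0 b0))
      as [h|h]; [exact h|].
    assert (l <= l - eps); [|pose proof (cond_pos eps); lra].
    apply hlub. intros v (a & b & ha & hab & ->).
    apply Rnot_lt_le. intros hlt. apply h. now exists a, b. }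
  destruct hex as (a0 & b0 & ha0 & hab0 & h0).
  exists (fun a => 0 < a < a0) (fun b => b0 < b).
  - exists (mkposreal a0 ha0). intros t ht ht0. split; [exact ht0|].
    apply Rabs_lt_between in ht. simpl in ht.
    unfold minus, plus, opp in ht; simpl in ht. lra.
  - now exists b0.
  - intros a b ha hb. simpl. exists (RInt f a b).
    split; [apply (RInt_correct f), ex_RInt_continuous_pos; try assumption; lra|].
    apply hP. apply Rabs_lt_between.
    unfold minus, plus, opp; simpl.
    assert (h1 : RInt f a b = RInt f a a0 + RInt f a0 b0 + RInt f b0 b).
    { rewrite <- (RInt_Chasles f a a0 b) by (apply ex_RInt_continuous_pos; try assumption; lra).
      rewrite <- (RInt_Chasles f a0 b0 b) by (apply ex_RInt_continuous_pos; try assumption; lra).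
      unfold plus; simpl. ring. }
    assert (h2 : 0 <= RInt f a a0).
    { apply RInt_ge_0; [lra| apply ex_RInt_continuous_pos; try assumption; lra|].
      intros t ht. apply hp. lra. }
    assert (h3 : 0 <= RInt f b0 b).
    { apply RInt_ge_0; [lra| apply ex_RInt_continuous_pos; try assumption; lra|].
      intros t ht. apply hp. lra. }
    assert (RInt f a b <= l) by (apply hl; lra).
    pose proof (cond_pos eps). lra.
Qed.

Lemma exp_nondecreasing (u v : R) : u <= v -> exp u <= exp v.
Proof.
  intros [h| ->]; [apply Rlt_le, exp_increasing, h | apply Rle_refl].
Qed.

(** [t^p exp (-t)] has its maximum at [t = p], with value [p^p exp (-p)];
    the factor [exp (-p)] is bounded by [1]. *)
Lemma Rpower_le_exp (p t : R) :
  0 < p -> 0 < t -> Rpower t p <= Rpower p p * exp t.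
Proof.
  intros hp ht. unfold Rpower. rewrite <- exp_plus. apply exp_nondecreasing.
  pose proof (exp_ineq1_le (ln (t / p))) as h.
  rewrite exp_ln in h by (apply Rdiv_lt_0_compat; assumption).
  rewrite ln_div in h by assumption.
  apply (Rmult_le_compat_l p) in h; [|lra].
  replace (p * (t / p)) with t in h by (field; lra). lra.
Qed.

(** A bounded primitive whose derivative behaves like [t^(x-1)] at [0] and like
    [t^(-x-1)] at infinity: it dominates Euler's integrand on the whole half-line
    without splitting it. *)
Lemma is_derive_Gamma_majorant_primitive (x t : R) :
  0 < x -> 0 < t ->
  is_derive (fun t => - / (1 + Rpower t x)) t
    (x * Rpower t (x - 1) / (1 + Rpower t x) ^ 2).
Proof.
  intros hx ht.
  assert (E : Rpower t (x - 1) = Rpower t x / t).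
  { unfold Rpower. rewrite <- (exp_ln t) at 3 by exact ht.
    unfold Rdiv. rewrite <- exp_Ropp, <- exp_plus. f_equal. ring. }
  assert (0 < Rpower t x) by apply exp_pos.
  rewrite E. unfold Rpower in *. auto_derive.
  - repeat split; [exact ht | lra].
  - field. lra.
Qed.

Lemma Gamma_integrand_le (x t : R) :
  0 < x -> 0 < t ->
  Gamma_integrand x t
  <= 2 * (1 + Rpower (2 * x) (2 * x)) / x
     * (x * Rpower t (x - 1) / (1 + Rpower t x) ^ 2).
Proof.
  intros hx ht. unfold Gamma_integrand.
  set (A := Rpower t (x - 1)). set (B := Rpower t x).
  set (C := Rpower (2 * x) (2 * x)).
  assert (hA : 0 < A) by apply exp_pos.
  assert (hB : 0 < B) by apply exp_pos.
  assert (hC : 0 < C) by apply exp_pos.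
  pose proof (Rpower_le_exp (2 * x) t ltac:(lra) ht) as h.
  (* With [B = t^x]: [(1 + B)^2 <= 2 (1 + B^2)], and both [1] and [B^2 = t^(2x)]
     are controlled by [exp t]. *)
  replace (Rpower t (2 * x)) with (B * B) in h
    by (unfold B; rewrite <- Rpower_plus; f_equal; ring).
  fold C in h.
  pose proof (exp_ineq1_le t) as he.
  rewrite exp_Ropp.
  assert (0 < exp t) by apply exp_pos.
  replace (2 * (1 + C) / x * (x * A / (1 + B) ^ 2))
    with (A * (2 * (1 + C) / (1 + B) ^ 2)) by (field; lra).
  apply Rmult_le_compat_l; [lra|].
  assert (hB2 : (1 + B) ^ 2 > 0) by (apply pow_lt; lra).
  apply (proj1 (Rle_div_r _ _ _ hB2)).
  apply (Rmult_le_reg_l (exp t)); [assumption|].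
  rewrite <- Rmult_assoc, Rinv_r, Rmult_1_l by lra.
  assert (0 <= (1 - B) ^ 2) by apply pow2_ge_0.
  nra.
Qed.

Lemma is_RInt_gen_Gamma_pos (x : R) :
  0 < x ->
  is_RInt_gen (Gamma_integrand x) (at_right 0) (Rbar_locally p_infty) (Gamma x)
  /\ 0 < Gamma x.
Proof.
  intros hx.
  set (C := 2 * (1 + Rpower (2 * x) (2 * x)) / x).
  assert (hC : 0 < C).
  { apply Rdiv_lt_0_compat; [|exact hx].
    assert (0 < Rpower (2 * x) (2 * x)) by apply exp_pos. lra. }
  set (K' := fun t => x * Rpower t (x - 1) / (1 + Rpower t x) ^ 2).
  assert (hK' : forall t, 0 < t -> continuous K' t).
  { intros t ht. apply (ex_derive_continuous K').
    assert (0 < Rpower t x) by apply exp_pos.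
    unfold K', Rpower in *. auto_derive. repeat split; try assumption. nra. }
  destruct (ex_RInt_gen_bounded (Gamma_integrand x) C) as (l & hl & hle).
  - apply continuous_Gamma_integrand.
  - intros t _. apply Rlt_le, Gamma_integrand_pos.
  - intros a b ha hab.
    assert (hI : is_RInt K' a b (minus (- / (1 + Rpower b x)) (- / (1 + Rpower a x)))).
    { apply (is_RInt_derive (fun t => - / (1 + Rpower t x)));
        rewrite Rmin_left, Rmax_right by exact hab; intros t ht.
      - apply is_derive_Gamma_majorant_primitive; lra.
      - apply hK'. lra. }
    apply (is_RInt_scal _ _ _ C) in hI.
    change (is_RInt (fun t => C * K' t) a b
      (C * (- / (1 + Rpower b x) + - - / (1 + Rpower a x)))) in hI.
    apply Rle_trans with (RInt (fun t => C * K' t) a b).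
    + apply RInt_le; [exact hab| | |].
      * apply ex_RInt_continuous_pos; [apply continuous_Gamma_integrand|lra|lra].
      * eexists. exact hI.
      * intros t ht. apply Gamma_integrand_le; lra.
    + rewrite (is_RInt_unique _ _ _ _ hI).
      assert (0 < / (1 + Rpower b x))
        by (apply Rinv_0_lt_compat; pose proof (exp_pos (x * ln b)); unfold Rpower; lra).
      assert (/ (1 + Rpower a x) <= 1).
      { rewrite <- Rinv_1 at 2. apply Rinv_le_contravar; [lra|].
        pose proof (exp_pos (x * ln a)); unfold Rpower; lra. }
      nra.
  - assert (E : Gamma x = l).
    { apply (is_RInt_gen_unique (Gamma_integrand x)); exact hl. }
    rewrite E. split; [exact hl|].
    apply Rlt_le_trans with (RInt (Gamma_integrand x) 1 2); [|apply hle; lra].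
    apply RInt_gt_0; [lra| |].
    + intros t _. apply Gamma_integrand_pos.
    + intros t ht. apply continuous_Gamma_integrand. lra.
Qed.

Lemma is_RInt_gen_Gamma (x : R) :
  0 < x ->
  is_RInt_gen (Gamma_integrand x) (at_right 0) (Rbar_locally p_infty) (Gamma x).
Proof. intros hx. now apply is_RInt_gen_Gamma_pos. Qed.

Lemma Gamma_pos (x : R) : 0 < x -> 0 < Gamma x.
Proof. intros hx. now apply is_RInt_gen_Gamma_pos. Qed.

Lemma Gamma_boundary_at_0 (x : R) :
  0 < x -> filterlim (fun t => Rpower t x * exp (- t)) (at_right 0) (locally 0).
Proof.
  intros hx.
  apply (filterlim_le_le (fun _ => 0) _ (fun t => Rpower t x) (Finite 0)).
  - exists (mkposreal 1 Rlt_0_1). intros t _ ht.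
    assert (0 < Rpower t x) by apply exp_pos.
    assert (exp (- t) <= 1) by (rewrite <- exp_0; apply exp_nondecreasing; lra).
    assert (0 < exp (- t)) by apply exp_pos. nra.
  - apply filterlim_const.
  - unfold Rpower.
    apply (filterlim_comp _ _ _ (fun t => x * ln t) exp _ (Rbar_locally m_infty));
      [|exact is_lim_exp_m].
    apply (filterlim_comp _ _ _ ln (fun u => x * u) _ (Rbar_locally m_infty));
      [exact is_lim_ln_0|].
    intros P [M hM]. exists (M / x). intros u hu. apply hM.
    apply (proj2 (Rlt_div_r _ _ _ hx)) in hu. lra.
Qed.

Lemma Gamma_boundary_at_infinity (x : R) :
  0 < x ->
  filterlim (fun t => Rpower t x * exp (- t)) (Rbar_locally p_infty) (locally 0).
Proof.
  intros hx.
  set (C := Rpower (x + 1) (x + 1)).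
  apply (filterlim_le_le (fun _ => 0) _ (fun t => C * / t) (Finite 0)).
  - exists 0. intros t ht.
    assert (hP : 0 < Rpower t x) by apply exp_pos.
    assert (he : 0 < exp (- t)) by apply exp_pos.
    split; [nra|].
    pose proof (Rpower_le_exp (x + 1) t ltac:(lra) ht) as h. fold C in h.
    rewrite Rpower_plus, Rpower_1 in h by exact ht.
    apply (proj1 (Rle_div_r _ _ _ (ht : t > 0))).
    apply (Rmult_le_compat_r (exp (- t))) in h; [|lra].
    rewrite (Rmult_assoc C), <- exp_plus, Rplus_opp_r, exp_0 in h. lra.
  - apply filterlim_const.
  - replace (Finite 0) with (Rbar_mult C (Rbar_inv p_infty)) by (simpl; f_equal; ring).
    apply (is_lim_scal_l (fun t => / t) C p_infty).
    apply (is_lim_inv (fun t => t)); [apply is_lim_id|discriminate].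
Qed.

(** Integration by parts, with both boundary terms vanishing. *)
Lemma Gamma_succ (x : R) : 0 < x -> Gamma (x + 1) = x * Gamma x.
Proof.
  intros hx.
  set (F := fun t => Rpower t x * exp (- t)).
  (* [F' = G], so the integral of [G] is the boundary term [0 - 0]. *)
  set (G := fun t => x * Gamma_integrand x t - Gamma_integrand (x + 1) t).
  assert (hF : forall t, 0 < t -> is_derive F t (G t)).
  { intros t ht. unfold F, G, Gamma_integrand.
    replace (x + 1 - 1) with x by ring.
    assert (E : Rpower t (x - 1) = Rpower t x / t).
    { unfold Rpower. rewrite <- (exp_ln t) at 3 by exact ht.
      unfold Rdiv. rewrite <- exp_Ropp, <- exp_plus. f_equal. ring. }
    rewrite E. unfold Rpower. auto_derive; [exact ht|]. field. lra. }
  assert (hD : is_RInt_gen (Derive F) (at_right 0) (Rbar_locally p_infty) (0 - 0)).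
  { apply is_RInt_gen_Derive.
    - apply filter_prod_ordered_pos.
      intros a b ha hab t ht. simpl in *. rewrite Rmin_left in ht by exact hab.
      eexists. apply hF. lra.
    - apply filter_prod_ordered_pos.
      intros a b ha hab t ht. simpl in *. rewrite Rmin_left in ht by exact hab.
      assert (h0 : 0 < t) by lra.
      apply (continuous_ext_loc _ G).
      + apply (filter_imp (fun u => 0 < u)); [|now apply (open_gt 0)].
        intros u hu. symmetry. now apply is_derive_unique, hF.
      + apply (@continuous_minus R_UniformSpace R_AbsRing R_NormedModule).
        * apply (continuous_scal_r x (Gamma_integrand x)).
          now apply continuous_Gamma_integrand.
        * now apply continuous_Gamma_integrand.
    - now apply Gamma_boundary_at_0.
    - now apply Gamma_boundary_at_infinity. }
  assert (hG : is_RInt_gen G (at_right 0) (Rbar_locally p_infty)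
                 (x * Gamma x - Gamma (x + 1))).
  { apply (@is_RInt_gen_minus R_NormedModule); try apply filter_filter.
    - apply (@is_RInt_gen_scal R_NormedModule); try apply filter_filter.
      now apply is_RInt_gen_Gamma.
    - apply is_RInt_gen_Gamma. lra. }
  assert (hG' : is_RInt_gen G (at_right 0) (Rbar_locally p_infty) (0 - 0)).
  { apply (is_RInt_gen_ext (Derive F)); [|exact hD].
    apply filter_prod_ordered_pos.
    intros a b ha hab t ht. simpl in *. rewrite Rmin_left in ht by exact hab.
    apply is_derive_unique, hF. lra. }
  pose proof (is_RInt_gen_unique _ _ hG). pose proof (is_RInt_gen_unique _ _ hG').
  lra.
Qed.

(** Convexity of [exp]: the tangent line at [s ln u] is evaluated at [ln u] and at
    [0], with weights [s] and [1 - s]. *)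
Lemma Rpower_weighted_AM_GM (s u : R) :
  0 <= s <= 1 -> 0 < u -> Rpower u s <= 1 - s + s * u.
Proof.
  intros hs hu. unfold Rpower. set (w := ln u).
  assert (h : forall v, exp (s * w) * (1 + (v - s * w)) <= exp v).
  { intros v. replace (exp v) with (exp (s * w) * exp (v - s * w))
      by (rewrite <- exp_plus; f_equal; ring).
    apply Rmult_le_compat_l; [apply Rlt_le, exp_pos | apply exp_ineq1_le]. }
  pose proof (h w) as h1. pose proof (h 0) as h0. rewrite exp_0 in h0.
  unfold w in h1 at 4. rewrite exp_ln in h1 by exact hu.
  apply (Rmult_le_compat_l s) in h1; [|lra].
  apply (Rmult_le_compat_l (1 - s)) in h0; [|lra].
  nra.
Qed.

(** Inside the integral, [t^s <= (1 - s) x^s + s x^(s-1) t], the tangent line at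
    [t = x]. It integrates to [x^s Gamma x] because [Gamma (x+1) = x Gamma x].
    The
    result expresses the log-convexity of [Gamma]. *)
Lemma Gamma_Wendel (x s : R) :
  0 < x -> 0 <= s <= 1 -> Gamma (x + s) <= Rpower x s * Gamma x.
Proof.
  intros hx hs.
  set (c := (1 - s) * Rpower x s). set (d := s * Rpower x s / x).
  assert (hI : is_RInt_gen (fun t => plus (scal c (Gamma_integrand x t))
                                      (scal d (Gamma_integrand (x + 1) t)))
     (at_right 0) (Rbar_locally p_infty) (plus (scal c (Gamma x)) (scal d (Gamma (x + 1))))).
  { apply (@is_RInt_gen_plus R_NormedModule); try apply filter_filter;
      apply (@is_RInt_gen_scal R_NormedModule); try apply filter_filter;
      apply is_RInt_gen_Gamma; lra. }
  assert (E : plus (scal c (Gamma x)) (scal d (Gamma (x + 1))) = Rpower x s * Gamma x).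
  { rewrite Gamma_succ by exact hx. unfold plus, scal, c, d; simpl. unfold mult; simpl.
    field. lra. }
  rewrite E in hI.
  rewrite <- (Rabs_right (Gamma (x + s))) by (apply Rle_ge, Rlt_le, Gamma_pos; lra).
  apply (RInt_gen_norm (V := R_CompleteNormedModule)
     (Fa := at_right 0) (Fb := Rbar_locally p_infty) (Gamma_integrand (x + s)) _ _ _)
     with (3 := is_RInt_gen_Gamma (x + s) ltac:(lra)) (4 := hI).
  - apply filter_prod_ordered_pos.
    intros a b _ h. exact h.
  - apply filter_prod_ordered_pos.
    intros a b ha hab t ht. simpl in *.
    assert (ht0 : 0 < t) by lra.
    unfold norm; simpl. unfold abs; simpl.
    rewrite Rabs_right by apply Rle_ge, Rlt_le, Gamma_integrand_pos.
    unfold plus, scal, c, d, Gamma_integrand; simpl. unfold mult; simpl.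
    replace (x + s - 1) with (x - 1 + s) by ring.
    replace (x + 1 - 1) with (x - 1 + 1) by ring.
    rewrite !Rpower_plus, Rpower_1 by exact ht0.
    pose proof (Rpower_weighted_AM_GM s (t / x) hs ltac:(apply Rdiv_lt_0_compat; lra)) as h.
    assert (E2 : Rpower t s = Rpower x s * Rpower (t / x) s).
    { rewrite Rpower_mult_distr by (try apply Rdiv_lt_0_compat; lra).
      f_equal. field. lra. }
    rewrite E2.
    replace ((1 - s) * Rpower x s * (Rpower t (x - 1) * exp (- t)) +
       s * Rpower x s / x * (Rpower t (x - 1) * t * exp (- t)))
      with (Rpower t (x - 1) * Rpower x s * exp (- t) * (1 - s + s * (t / x)))
      by (field; lra).
    replace (Rpower t (x - 1) * (Rpower x s * Rpower (t / x) s) * exp (- t))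
      with (Rpower t (x - 1) * Rpower x s * exp (- t) * Rpower (t / x) s) by ring.
    apply Rmult_le_compat_l; [|exact h].
    apply Rlt_le. repeat apply Rmult_lt_0_compat; apply exp_pos.
Qed.

(** * The logarithmic derivative of Gamma *)

Lemma locally_pos (x : R) : 0 < x -> locally x (fun t => 0 < t).
Proof. exact (open_gt 0 x). Qed.

Lemma is_derive_0_constant (f : R -> R) :
  (forall x, 0 < x -> is_derive f x 0) ->
  forall x y, 0 < x -> 0 < y -> f x = f y.
Proof.
  intros hf x y hx hy.
  assert (hm : 0 < Rmin x y) by now apply Rmin_glb_lt.
  destruct (MVT_gen f x y (fun _ => 0)) as (c & _ & hc).
  - intros z hz. apply hf. lra.
  - intros z hz. apply derivable_continuous_pt, ex_derive_Reals_0.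
    exists 0. apply hf. lra.
  - lra.
Qed.

Lemma MVT_pos (f df : R -> R) (x y : R) :
  (forall t, 0 < t -> is_derive f t (df t)) -> 0 < x -> x <= y ->
  exists c, x <= c <= y /\ f y - f x = df c * (y - x).
Proof.
  intros hf hx hxy.
  destruct (MVT_gen f x y df) as (c & hc & E).
  - intros z hz. apply hf. rewrite Rmin_left in hz by exact hxy. lra.
  - intros z hz. rewrite Rmin_left in hz by exact hxy.
    apply derivable_continuous_pt, ex_derive_Reals_0.
    eexists. apply hf. lra.
  - exists c. rewrite Rmin_left, Rmax_right in hc by exact hxy. now split.
Qed.

Lemma is_derive_RInt_pos (f : R -> R) (x : R) :
  (forall t, 0 < t -> continuous f t) -> 0 < x ->
  is_derive (fun u => RInt f 1 u) x (f x).
Proof.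
  intros hf hx. apply (is_derive_RInt f (fun u => RInt f 1 u) 1); [|now apply hf].
  apply (filter_imp (fun t => 0 < t)); [|now apply locally_pos].
  intros t ht. apply (RInt_correct f), ex_RInt_continuous_pos; [exact hf|lra|exact ht].
Qed.

(** The form in which limits as [n] tends to infinity are taken below: explicit
    inequalities at integers in place of filters. *)
Lemma le_inv_INR_0 (c M : R) :
  (forall n, (1 <= n)%nat -> c <= M / INR n) -> c <= 0.
Proof.
  intros h. apply Rnot_lt_le. intros hc.
  destruct (nfloor_ex (Rabs M / c)) as [n [_ hn]].
  { apply Rdiv_le_0_compat; [apply Rabs_pos|exact hc]. }
  specialize (h (S n) ltac:(lia)). rewrite S_INR in h.
  pose proof (pos_INR n) as hp.
  assert (h1 : INR n + 1 > 0) by lra.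
  apply (proj2 (Rle_div_r _ _ _ h1)) in h.
  apply (proj1 (Rlt_div_l _ _ _ hc)) in hn.
  pose proof (Rle_abs M). lra.
Qed.

Lemma Rabs_le_inv_INR_0 (c M : R) :
  (forall n, (1 <= n)%nat -> Rabs c <= M / INR n) -> c = 0.
Proof.
  intros h. apply le_inv_INR_0 in h.
  apply Rabs_le_between in h. lra.
Qed.

Lemma hurwitz2_pos (x : R) : 0 < x -> 0 < hurwitz 2 x.
Proof.
  intros hx. eapply Rlt_le_trans; [|apply (hurwitz_bounds 1); [lia|exact hx]].
  unfold power_tail. simpl.
  apply Rplus_lt_0_compat; [apply Rinv_0_lt_compat|apply Rdiv_lt_0_compat]; nra.
Qed.

(** The shift equation [zeta (2, x) = 1 / x^2 + zeta (2, x+1)] survives two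
    integrations up to constants. The first constant vanishes because
    [zeta (2, .)] tends to [0] at infinity; the second is removed by subtracting
    a linear function. *)
Lemma log_gamma_candidate :
  exists g p : R -> R, forall x, 0 < x ->
    is_derive g x (p x) /\ is_derive p x (hurwitz 2 x) /\ g (x + 1) - g x = ln x.
Proof.
  (* The candidate for the digamma function, up to an additive constant. *)
  set (q := fun x => RInt (hurwitz 2) 1 x).
  assert (hq : forall x, 0 < x -> is_derive q x (hurwitz 2 x)).
  { intros x hx. apply is_derive_RInt_pos; [|exact hx].
    intros t ht. apply (ex_derive_continuous (hurwitz 2)).
    eexists. apply (is_derive_hurwitz 1); [lia|exact ht]. }
  assert (hq1 : forall x, 0 < x -> q (x + 1) - q x = / x).
  { set (r := fun x => q (x + 1) - q x - / x).
    assert (hr : forall x, 0 < x -> is_derive r x 0).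
    { intros x hx. unfold r.
      replace 0 with (1 * hurwitz 2 (x + 1) - hurwitz 2 x - - / x ^ 2)
        by (rewrite (hurwitz_shift 1 x) by (lia || exact hx); ring).
      apply (is_derive_minus (fun x => q (x + 1) - q x) Rinv).
      - apply (is_derive_minus (fun x => q (x + 1)) q); [|now apply hq].
        apply (is_derive_comp q (fun x => x + 1)); [apply hq; lra|].
        auto_derive; [exact I|ring].
      - auto_derive; [lra|]. field. lra. }
    assert (hr0 : forall x, 0 < x -> r x = 0).
    { intros x hx. apply (Rabs_le_inv_INR_0 _ 3). intros n hn.
      assert (hn' : 1 <= INR n) by now apply (le_INR 1).
      rewrite (is_derive_0_constant r hr x (INR n) hx ltac:(lra)).
      destruct (MVT_pos q (hurwitz 2) (INR n) (INR n + 1) hq) as (c & hc & E);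
        [lra|lra|].
      unfold r. rewrite E.
      replace (INR n + 1 - INR n) with 1 by ring. rewrite Rmult_1_r.
      pose proof (hurwitz_le_2_div 1 c ltac:(lia) ltac:(lra)) as h1.
      pose proof (hurwitz2_pos c ltac:(lra)) as h2.
      assert (/ c <= / INR n) by (apply Rinv_le_contravar; lra).
      assert (0 < / INR n) by (apply Rinv_0_lt_compat; lra).
      unfold Rdiv in *. apply Rabs_le. lra. }
    intros x hx. specialize (hr0 x hx). unfold r in hr0. lra. }
  set (G := fun x => RInt q 1 x).
  assert (hG : forall x, 0 < x -> is_derive G x (q x)).
  { intros x hx. apply is_derive_RInt_pos; [|exact hx].
    intros t ht. apply (ex_derive_continuous q). eexists. now apply hq. }
  (* [c] is the value at [x = 1] of the constant [G (x + 1) - G x - ln x]. *)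
  set (c := G 2 - G 1).
  exists (fun x => G x - c * x), (fun x => q x - c).
  intros x hx. split; [|split].
  - apply (is_derive_minus G (fun x => c * x)); [now apply hG|].
    auto_derive; [exact I|ring].
  - replace (hurwitz 2 x) with (hurwitz 2 x - 0) by ring.
    apply (is_derive_minus q (fun _ => c)); [now apply hq|].
    apply (is_derive_const c).
  - set (r := fun x => G (x + 1) - G x - ln x).
    assert (hr : forall x, 0 < x -> is_derive r x 0).
    { intros z hz. unfold r.
      replace 0 with (1 * q (z + 1) - q z - / z)
        by (rewrite <- hq1 by exact hz; ring).
      apply (is_derive_minus (fun x => G (x + 1) - G x) ln).
      - apply (is_derive_minus (fun x => G (x + 1)) G); [|now apply hG].
        apply (is_derive_comp G (fun x => x + 1)); [apply hG; lra|].
        auto_derive; [exact I|ring].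
      - auto_derive; [lra|]. field. lra. }
    pose proof (is_derive_0_constant r hr x 1 hx Rlt_0_1) as E.
    unfold r in E. rewrite ln_1 in E. replace (1 + 1) with 2 in E by ring.
    unfold c. lra.
Qed.

Lemma ln_le_sub_1 (u : R) : 0 < u -> ln u <= u - 1.
Proof.
  intros hu. pose proof (exp_ineq1_le (ln u)) as h. rewrite exp_ln in h by exact hu. lra.
Qed.

Lemma ln_Gamma_succ (x : R) : 0 < x -> ln (Gamma (x + 1)) = ln (Gamma x) + ln x.
Proof.
  intros hx. rewrite Gamma_succ, ln_mult by (try apply Gamma_pos; exact hx). ring.
Qed.

(** Wendel's inequality from [x] to [x + s] gives the upper bound; from [x + s] to
    [x + 1] it gives the lower bound. *)
Lemma ln_Gamma_increment (x s : R) :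
  0 < x -> 0 <= s <= 1 ->
  - / x <= ln (Gamma (x + s)) - ln (Gamma x) - s * ln x <= 0.
Proof.
  intros hx hs.
  assert (W : forall z r, 0 < z -> 0 <= r <= 1 ->
            ln (Gamma (z + r)) <= r * ln z + ln (Gamma z)).
  { intros z r hz hr.
    rewrite <- (ln_exp (r * ln z)), <- ln_mult
      by (apply exp_pos || now apply Gamma_pos).
    apply ln_le; [apply Gamma_pos; lra|]. now apply Gamma_Wendel. }
  pose proof (W x s hx hs) as h1.
  pose proof (W (x + s) (1 - s) ltac:(lra) ltac:(lra)) as h2.
  replace (x + s + (1 - s)) with (x + 1) in h2 by ring.
  rewrite ln_Gamma_succ in h2 by exact hx.
  assert (h3 : ln (x + s) - ln x <= / x).
  { rewrite <- ln_div by lra.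
    eapply Rle_trans; [apply ln_le_sub_1, Rdiv_lt_0_compat; lra|].
    replace ((x + s) / x - 1) with (s * / x) by (field; lra).
    assert (0 < / x) by now apply Rinv_0_lt_compat. nra. }
  assert (0 <= ln (x + s) - ln x).
  { assert (ln x <= ln (x + s)) by (apply ln_le; lra). lra. }
  split; [|lra]. nra.
Qed.

(** [ln Gamma] and the function [g] of [log_gamma_candidate] have a 1-periodic
    difference [d]. Both [ln Gamma] and [g] satisfy
    [f (x + s) - f x = s ln x + O (1/x)] for [0 <= s <= 1], so the increments of
    [d] are smaller than any positive number after translation by a large
    integer, and [d] is constant. *)
Lemma is_derive_ln_Gamma_digamma (x : R) :
  0 < x ->
  is_derive (fun t => ln (Gamma t)) x (digamma x) /\
  is_derive digamma x (hurwitz 2 x).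
Proof.
  destruct log_gamma_candidate as (g & p & hgp).
  assert (hg : forall x, 0 < x -> is_derive g x (p x)) by apply hgp.
  assert (hp : forall x, 0 < x -> is_derive p x (hurwitz 2 x)) by apply hgp.
  assert (hg1 : forall x, 0 < x -> g (x + 1) - g x = ln x) by apply hgp.
  set (d := fun x => ln (Gamma x) - g x).
  assert (hd1 : forall x, 0 < x -> d (x + 1) = d x).
  { intros z hz. unfold d. rewrite ln_Gamma_succ by exact hz.
    specialize (hg1 z hz). lra. }
  assert (hdn : forall n x, 0 < x -> d (x + INR n) = d x).
  { induction n as [|n IH]; intros z hz.
    - simpl. now rewrite Rplus_0_r.
    - rewrite S_INR, <- Rplus_assoc, hd1; [now apply IH|]. now apply shift_pos. }
  assert (hds : forall x s, 0 < x -> 0 <= s <= 1 -> d (x + s) = d x).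
  { intros z s hz hs.
    assert (E : d (z + s) - d z = 0); [|lra].
    apply (Rabs_le_inv_INR_0 _ 3). intros n hn.
    assert (hn' : 1 <= INR n) by now apply (le_INR 1).
    rewrite <- (hdn n z hz), <- (hdn n (z + s)) by lra.
    replace (z + s + INR n) with (z + INR n + s) by ring.
    set (w := z + INR n). assert (hw : INR n <= w) by (unfold w; lra).
    pose proof (ln_Gamma_increment w s ltac:(lra) hs) as hG.
    destruct (MVT_pos g p w (w + s) hg ltac:(lra) ltac:(lra)) as (c1 & hc1 & E1).
    destruct (MVT_pos g p w (w + 1) hg ltac:(lra) ltac:(lra)) as (c2 & hc2 & E2).
    rewrite hg1 in E2 by lra.
    replace (w + 1 - w) with 1 in E2 by ring.
    replace (w + s - w) with s in E1 by ring.
    (* The mean slopes of [g] over [[w, w + s]] and [[w, w + 1]] are values of [p]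
       at two points of [[w, w + 1]], where [p] varies by at most [2 / w]. *)
    assert (hlip : forall u v, w <= u -> u <= v -> v <= w + 1 ->
              0 <= p v - p u <= 2 * / w).
    { intros u v h1 h2 h3.
      destruct (MVT_pos p (hurwitz 2) u v hp ltac:(lra) h2) as (c & hc & E).
      pose proof (hurwitz_le_2_div 1 c ltac:(lia) ltac:(lra)).
      pose proof (hurwitz2_pos c ltac:(lra)).
      assert (/ c <= / w) by (apply Rinv_le_contravar; lra).
      unfold Rdiv in *. rewrite E. split; [nra|]. nra. }
    assert (hcc : - (2 * / w) <= p c1 - p c2 <= 2 * / w).
    { destruct (Rle_dec c1 c2) as [h|h].
      - pose proof (hlip c1 c2 ltac:(lra) h ltac:(lra)). lra.
      - pose proof (hlip c2 c1 ltac:(lra) ltac:(lra) ltac:(lra)). lra. }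
    assert (hwn : / w <= / INR n) by (apply Rinv_le_contravar; lra).
    assert (0 < / w) by (apply Rinv_0_lt_compat; lra).
    unfold d. apply Rabs_le.
    replace (ln (Gamma (w + s)) - g (w + s) - (ln (Gamma w) - g w))
      with (ln (Gamma (w + s)) - ln (Gamma w) - s * ln w - s * (p c1 - p c2))
      by (rewrite E2; lra).
    unfold Rdiv. nra. }
  assert (hln : forall x, 0 < x -> is_derive (fun t => ln (Gamma t)) x (p x)).
  { intros z hz.
    apply (is_derive_ext_loc (fun t => g t + d z)).
    - apply (filter_imp (fun t => 0 < t /\ z - 1 < t /\ t < z + 1)).
      + intros t (h0 & h1 & h2).
        assert (E : d t = d z).
        { destruct (Rle_dec z t) as [h|h].
          - replace t with (z + (t - z)) by ring. apply hds; lra.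
          - replace z with (t + (z - t)) by ring. symmetry. apply hds; lra. }
        rewrite <- E. apply Rminus_diag_uniq. unfold d. ring.
      + repeat apply filter_and.
        * now apply locally_pos.
        * apply (open_gt (z - 1)). lra.
        * apply (open_lt (z + 1)). lra.
    - replace (p z) with (p z + 0) by ring.
      apply (is_derive_plus g (fun _ => d z)); [now apply hg|].
      apply (is_derive_const (d z)). }
  assert (hdig : forall x, 0 < x -> digamma x = p x).
  { intros z hz. unfold digamma.
    assert (hpos := Gamma_pos z hz).
    assert (hD : is_derive Gamma z (p z * Gamma z)).
    { apply (is_derive_ext_loc (fun t => exp (ln (Gamma t)))).
      - apply (filter_imp (fun t => 0 < t)); [|now apply locally_pos].
        intros t ht. now apply exp_ln, Gamma_pos.
      - rewrite <- (exp_ln (Gamma z)) at 1 by exact hpos.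
        apply (is_derive_comp exp (fun t => ln (Gamma t))); [|now apply hln].
        apply is_derive_exp. }
    rewrite (is_derive_unique _ _ _ hD). field. lra. }
  intros hx. split.
  - rewrite hdig by exact hx. now apply hln.
  - apply (is_derive_ext_loc p); [|now apply hp].
    apply (filter_imp (fun t => 0 < t)); [|now apply locally_pos].
    intros t ht. symmetry. now apply hdig.
Qed.

(** * The derivatives of ln h *)

(** The derivative of order [k] of the digamma function on the positive half-line,
    as an explicit formula for which differentiability is known. *)
Definition polygamma (k : nat) (x : R) : R :=
  match k with
  | O => digamma x
  | S _ => (-1) ^ S k * INR (fact k) * hurwitz (S k) x
  end.

Lemma is_derive_polygamma (k : nat) (x : R) :
  0 < x -> is_derive (polygamma k) x (polygamma (S k) x).
Proof.
  intros hx. destruct k as [|k].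
  - replace (polygamma 1 x) with (hurwitz 2 x) by (unfold polygamma; simpl; ring).
    now apply is_derive_ln_Gamma_digamma.
  - replace (polygamma (S (S k)) x)
      with ((-1) ^ S (S k) * INR (fact (S k))
            * (- INR (S (S k)) * hurwitz (S (S (S k))) x)).
    + apply (is_derive_scal (hurwitz (S (S k)))). now apply is_derive_hurwitz; [lia|].
    + unfold polygamma. rewrite (fact_simpl (S k)), mult_INR. simpl pow. ring.
Qed.

Lemma continuous_polygamma (k : nat) (x : R) : 0 < x -> continuous (polygamma k) x.
Proof.
  intros hx. apply (ex_derive_continuous (polygamma k)).
  eexists. now apply is_derive_polygamma.
Qed.

Definition ln_derivative (k : nat) (x : R) : R :=
  match k with
  | O => ln x
  | S j => (-1) ^ j * INR (fact j) / x ^ k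
  end.

Lemma is_derive_ln_derivative (k : nat) (x : R) :
  0 < x -> is_derive (ln_derivative k) x (ln_derivative (S k) x).
Proof.
  intros hx. destruct k as [|j].
  - unfold ln_derivative. simpl. auto_derive; [exact hx|]. field. lra.
  - unfold ln_derivative.
    assert (0 < x ^ S j) by now apply pow_lt.
    assert (0 < x ^ j) by now apply pow_lt.
    auto_derive; [now apply Rgt_not_eq|].
    rewrite fact_simpl, mult_INR. cbn [Nat.pred pred].
    change (match j with 0%nat => 1 | S _ => INR j + 1 end) with (INR (S j)).
    simpl pow. field. lra.
Qed.

Definition moment (k : nat) (F : R -> R) (a x : R) : R :=
  RInt (fun s => s ^ k * F (a + x * s)) 0 1.

Lemma segment_pos (a x s : R) : 0 < a -> - a < x -> 0 <= s <= 1 -> 0 < a + x * s.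
Proof.
  intros ha hx hs. replace (a + x * s) with (a * (1 - s) + (x + a) * s) by ring.
  destruct (Req_dec s 0) as [->|h]; [lra|].
  apply Rplus_le_lt_0_compat.
  - apply Rmult_le_pos; lra.
  - apply Rmult_lt_0_compat; lra.
Qed.

Lemma continuous_moment_integrand (k : nat) (F : R -> R) (a x s : R) :
  (forall t, 0 < t -> continuous F t) -> 0 < a + x * s ->
  continuous (fun s => s ^ k * F (a + x * s)) s.
Proof.
  intros hF h.
  apply (@continuous_mult R_UniformSpace R_AbsRing).
  - apply (ex_derive_continuous (fun s : R => s ^ k)). auto_derive. exact I.
  - apply (continuous_comp (fun s : R => a + x * s) F); [|now apply hF].
    apply (ex_derive_continuous (fun s : R => a + x * s)). auto_derive. exact I.
Qed.

Lemma is_RInt_moment (k : nat) (F : R -> R) (a x : R) :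
  (forall t, 0 < t -> continuous F t) -> 0 < a -> - a < x ->
  is_RInt (fun s => s ^ k * F (a + x * s)) 0 1 (moment k F a x).
Proof.
  intros hF ha hx.
  apply (RInt_correct (fun s => s ^ k * F (a + x * s))).
  apply (@ex_RInt_continuous R_CompleteNormedModule).
  intros s hs. rewrite Rmin_left, Rmax_right in hs by lra.
  apply continuous_moment_integrand; [exact hF|]. now apply segment_pos.
Qed.

(** Differentiation under the integral sign; the factor [s] from the chain rule
    raises the order of the moment. *)
Lemma is_derive_moment (k : nat) (F F' : R -> R) (a x : R) :
  (forall t, 0 < t -> is_derive F t (F' t)) ->
  (forall t, 0 < t -> continuous F' t) ->
  0 < a -> - a < x ->
  is_derive (moment k F a) x (moment (S k) F' a x).
Proof.
  intros hF hF' ha hx.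
  assert (hd : forall u s, 0 < a + u * s ->
    is_derive (fun u => s ^ k * F (a + u * s)) u (s ^ S k * F' (a + u * s))).
  { intros u s h. replace (s ^ S k * F' (a + u * s)) with (s ^ k * (s * F' (a + u * s)))
      by (simpl; ring).
    apply (is_derive_scal (fun u => F (a + u * s))).
    apply (is_derive_comp F (fun u => a + u * s)); [now apply hF|].
    auto_derive; [exact I|ring]. }
  assert (hFc : forall t, 0 < t -> continuous F t).
  { intros t ht. apply (ex_derive_continuous F). eexists. now apply hF. }
  assert (hloc : locally x (fun u => - a < u)) by now apply (open_gt (- a)).
  unfold moment at 2.
  rewrite (RInt_ext _ (fun s => Derive (fun u => s ^ k * F (a + u * s)) x)).
  2:{ intros s hs. rewrite Rmin_left, Rmax_right in hs by lra.
      symmetry. apply is_derive_unique, hd. apply segment_pos; lra. }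
  apply (is_derive_RInt_param (fun u s => s ^ k * F (a + u * s)) 0 1 x).
  - revert hloc. apply filter_imp. intros u hu s hs.
    rewrite Rmin_left, Rmax_right in hs by lra.
    eexists. apply hd. now apply segment_pos.
  - intros s hs. rewrite Rmin_left, Rmax_right in hs by lra.
    pose proof (segment_pos a x s ha hx hs) as hpos.
    assert (hc2 : continuity_2d_pt (fun u v => a + u * v) x s).
    { apply continuity_2d_pt_plus; [apply continuity_2d_pt_const|].
      apply continuity_2d_pt_mult; [apply continuity_2d_pt_id1|apply continuity_2d_pt_id2]. }
    apply (continuity_2d_pt_ext_loc (fun u v => v ^ S k * F' (a + u * v))).
    (* A neighbourhood of [(x, s)] may leave [[0, 1]] in the second variable,
         but by continuity the argument of [F'] stays positive there. *)
    + destruct (hc2 (mkposreal _ hpos)) as [d hdl]. exists d.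
      intros u v hu hv. symmetry. apply is_derive_unique, hd.
      specialize (hdl u v hu hv). simpl in hdl. apply Rabs_lt_between in hdl. lra.
    + apply continuity_2d_pt_mult.
      * apply (continuity_1d_2d_pt_comp (fun v => v ^ S k) (fun _ v => v)).
        -- apply derivable_continuous_pt, ex_derive_Reals_0. auto_derive. exact I.
        -- apply continuity_2d_pt_id2.
      * apply (continuity_1d_2d_pt_comp F' (fun u v => a + u * v)); [|exact hc2].
        apply continuity_pt_filterlim. now apply hF'.
  - revert hloc. apply filter_imp. intros u hu.
    eexists. now apply is_RInt_moment.
Qed.

(** With [a = y + 1], the derivative of order [k] of [ln h]. *)
Definition ln_h_derivative (k : nat) (a alpha x : R) : R :=
  moment k (polygamma k) a x - alpha * ln_derivative k (x + a).

Lemma is_derive_ln_h_derivative (k : nat) (a alpha x : R) :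
  0 < a -> - a < x ->
  is_derive (ln_h_derivative k a alpha) x (ln_h_derivative (S k) a alpha x).
Proof.
  intros ha hx. unfold ln_h_derivative.
  apply (is_derive_minus (moment k (polygamma k) a)
           (fun x => alpha * ln_derivative k (x + a))).
  - apply is_derive_moment; [apply is_derive_polygamma|apply continuous_polygamma|
      exact ha|exact hx].
  - apply (is_derive_scal (fun x => ln_derivative k (x + a))).
    rewrite <- (Rmult_1_l (ln_derivative (S k) (x + a))).
    apply (is_derive_comp (ln_derivative k) (fun x => x + a)).
    + apply is_derive_ln_derivative. lra.
    + auto_derive; [exact I|ring].
Qed.

Lemma h_pos (alpha y x : R) : 0 < h alpha y x.
Proof.
  unfold h. destruct (Req_EM_T x 0).
  - apply Rmult_lt_0_compat; [|apply exp_pos]. apply Rdiv_lt_0_compat; [lra|apply exp_pos].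
  - apply Rmult_lt_0_compat; [|apply exp_pos]. apply Rdiv_lt_0_compat; [lra|apply exp_pos].
Qed.

(** The divided difference of [ln Gamma] between [y + 1] and [x + y + 1] is the
    mean of [digamma] on the segment joining them; this formula extends to [x = 0],
    where the integrand is constant. *)
Lemma ln_h (alpha y x : R) :
  -1 < y -> - y - 1 < x -> ln (h alpha y x) = ln_h_derivative 0 (y + 1) alpha x.
Proof.
  intros hy hx. unfold ln_h_derivative, moment, ln_derivative, polygamma, h.
  destruct (Req_EM_T x 0) as [->|hx0].
  - rewrite ln_mult by (apply exp_pos || (apply Rdiv_lt_0_compat; [lra|apply exp_pos])).
    rewrite ln_div by (lra || apply exp_pos). unfold Rpower. rewrite !ln_exp, ln_1.
    rewrite (RInt_ext _ (fun _ => digamma (y + 1))).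
    + rewrite RInt_const. unfold scal; simpl. unfold mult; simpl.
      rewrite Rplus_0_l. ring.
    + intros s _. simpl. rewrite Rmult_0_l, Rplus_0_r. ring.
  - assert (0 < Gamma (y + 1)) by (apply Gamma_pos; lra).
    assert (0 < Gamma (x + y + 1)) by (apply Gamma_pos; lra).
    rewrite ln_mult by (apply exp_pos || (apply Rdiv_lt_0_compat; [lra|apply exp_pos])).
    rewrite ln_div by (lra || apply exp_pos). unfold Rpower. rewrite !ln_exp, ln_1.
    rewrite ln_div by assumption.
    assert (hI : is_RInt (fun s => s ^ 0 * digamma (y + 1 + x * s)) 0 1
      (minus (/ x * ln (Gamma (y + 1 + x * 1))) (/ x * ln (Gamma (y + 1 + x * 0))))).
    { apply (is_RInt_derive (fun s => / x * ln (Gamma (y + 1 + x * s))));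
        rewrite Rmin_left, Rmax_right by lra; intros s hs;
        assert (hp : 0 < y + 1 + x * s) by (apply segment_pos; lra).
      - replace (s ^ 0 * digamma (y + 1 + x * s))
          with (/ x * (x * digamma (y + 1 + x * s))) by (simpl; now field).
        apply (is_derive_scal (fun s => ln (Gamma (y + 1 + x * s)))).
        apply (is_derive_comp (fun t => ln (Gamma t)) (fun s => y + 1 + x * s)).
        + now apply is_derive_ln_Gamma_digamma.
        + auto_derive; [exact I|ring].
      - apply continuous_moment_integrand; [|exact hp].
        exact (continuous_polygamma 0). }
    rewrite (is_RInt_unique _ _ _ _ hI). unfold minus, plus, opp; simpl.
    replace (y + 1 + x * 1) with (x + y + 1) by ring.
    replace (y + 1 + x * 0) with (y + 1) by ring.
    replace (x + (y + 1)) with (x + y + 1) by ring.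
    field. exact hx0.
Qed.

(** The identity behind the sharp constants: [power_tail a k], integrated with weight
    [s^k] along the segment from [a] to [x + a], is the monomial contributed by the factor
    [X^(-alpha)] of [h]. A primitive is [s^(k+1) / (k (a + x s)^k)]. *)
Lemma is_RInt_power_tail (k : nat) (a x : R) :
  (1 <= k)%nat -> 0 < a -> - a < x ->
  is_RInt (fun s => s ^ k * power_tail a k (a + x * s)) 0 1 (/ (INR k * (x + a) ^ k)).
Proof.
  intros hk ha hx.
  assert (hk' : 0 < INR k) by (apply lt_0_INR; lia).
  set (P := fun s => s ^ S k / (INR k * (a + x * s) ^ k)).
  assert (hpow : forall z n, 0 < z -> 0 < z ^ n) by (intros; now apply pow_lt).
  replace (/ (INR k * (x + a) ^ k)) with (minus (P 1) (P 0)).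
  2:{ unfold P, minus, plus, opp; simpl. rewrite pow1.
      replace (a + x * 1) with (x + a) by ring. replace (a + x * 0) with a by ring.
      pose proof (hpow (x + a) k ltac:(lra)). pose proof (hpow a k ltac:(lra)).
      field. lra. }
  apply (is_RInt_derive P (fun s => s ^ k * power_tail a k (a + x * s)));
    rewrite Rmin_left, Rmax_right by lra; intros s hs;
    pose proof (segment_pos a x s ha hx hs) as hp.
  - unfold P, power_tail. destruct k as [|j]; [lia|].
    pose proof (hpow _ j hp). pose proof (hpow _ (S j) hp).
    auto_derive.
    + apply Rgt_not_eq, Rmult_lt_0_compat; assumption.
    + cbn [Nat.pred pred].
      change (match j with 0%nat => 1 | S _ => INR j + 1 end) with (INR (S j)).
      replace (INR (S (S j))) with (INR (S j) + 1) by now rewrite (S_INR (S j)).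
      simpl pow. field. lra.
  - apply continuous_moment_integrand; [|exact hp].
    intros t ht. apply (ex_derive_continuous (power_tail a k)).
    pose proof (hpow t k ht). pose proof (hpow t (S k) ht).
    unfold power_tail. auto_derive. split; [|split; [|exact I]].
    + apply Rgt_not_eq, Rmult_lt_0_compat; assumption.
    + apply Rgt_not_eq; assumption.
Qed.

Lemma continuous_hurwitz (k : nat) (x : R) :
  (1 <= k)%nat -> 0 < x -> continuous (hurwitz (S k)) x.
Proof.
  intros hk hx. apply (ex_derive_continuous (hurwitz (S k))).
  eexists. now apply is_derive_hurwitz.
Qed.

Lemma signed_ln_h_derivative (k : nat) (a alpha x : R) :
  (1 <= k)%nat -> 0 < a -> - a < x ->
  (-1) ^ k * ln_h_derivative k a alpha x
  = INR (fact k) * (alpha / (INR k * (x + a) ^ k) - moment k (hurwitz (S k)) a x).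
Proof.
  intros hk ha hx. destruct k as [|j]; [lia|].
  unfold ln_h_derivative, ln_derivative, polygamma.
  assert (hs : (-1) ^ j * (-1) ^ j = 1).
  { rewrite <- Rpow_mult_distr. replace (-1 * -1) with 1 by ring. apply pow1. }
  assert (E : moment (S j) (fun z => (-1) ^ S (S j) * INR (fact (S j)) * hurwitz (S (S j)) z) a x
      = (-1) ^ j * INR (fact (S j)) * moment (S j) (hurwitz (S (S j))) a x).
  { apply is_RInt_unique.
    apply (is_RInt_ext (fun s => scal ((-1) ^ j * INR (fact (S j)))
             (s ^ S j * hurwitz (S (S j)) (a + x * s)))).
    - intros s _. unfold scal; simpl. unfold mult; simpl. ring.
    - apply (@is_RInt_scal R_NormedModule).
      apply is_RInt_moment; [|exact ha|exact hx].
      intros t ht. now apply continuous_hurwitz. }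
  change (polygamma (S j)) with
    (fun z => (-1) ^ S (S j) * INR (fact (S j)) * hurwitz (S (S j)) z).
  rewrite E.
  assert (0 < (x + a) ^ j) by (apply pow_lt; lra).
  assert (0 < INR (S j)) by (apply lt_0_INR; lia).
  rewrite fact_simpl, mult_INR.
  replace ((-1) ^ S j) with (- (-1) ^ j) by (simpl; ring).
  transitivity (((-1) ^ j * (-1) ^ j) * (INR (S j) * INR (fact j)) *
    (alpha / (INR (S j) * (x + a) ^ S j) - moment (S j) (hurwitz (S (S j))) a x)).
  - simpl pow. field. lra.
  - rewrite hs. ring.
Qed.

(** * Logarithmic complete monotonicity through a chain of derivatives *)

Lemma derivative_chain (c : R) (f : R -> R) (g : nat -> R -> R) :
  (forall k x, c < x -> is_derive (g k) x (g (S k) x)) ->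
  (forall x, c < x -> f x = g O x) ->
  forall k x, c < x -> ex_derive_n f k x /\ Derive_n f k x = g k x.
Proof.
  intros hg hf k. induction k as [|k IH]; intros x hx.
  - split; [exact I|]. now apply hf.
  - assert (hd : is_derive (Derive_n f k) x (g (S k) x)).
    { apply (is_derive_ext_loc (g k)); [|now apply hg].
      apply (filter_imp (fun t => c < t)); [|now apply (open_gt c)].
      intros t ht. symmetry. now apply IH. }
    split; [now exists (g (S k) x)|]. now apply is_derive_unique.
Qed.

(** The derivative is provided by a witness on the half-line, which makes closure
    under products and under [exp] a plain induction, unlike with iterated
    [Derive]. *)
Fixpoint differentiable_upto (c : R) (n : nat) (f : R -> R) : Prop :=
  match n with
  | O => True
  | S n => exists f', (forall x, c < x -> is_derive f x (f' x)) /\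
                      differentiable_upto c n f'
  end.

Lemma differentiable_upto_pred (c : R) (n : nat) (f : R -> R) :
  differentiable_upto c (S n) f -> differentiable_upto c n f.
Proof.
  revert f. induction n as [|n IH]; intros f (f' & hf & hn); [exact I|].
  exists f'. split; [exact hf|]. now apply IH.
Qed.

Lemma differentiable_upto_plus (c : R) (n : nat) (f g : R -> R) :
  differentiable_upto c n f -> differentiable_upto c n g ->
  differentiable_upto c n (fun x => f x + g x).
Proof.
  revert f g. induction n as [|n IH]; [easy|].
  intros f g (f' & hf & hf') (g' & hg & hg').
  exists (fun x => f' x + g' x). split; [|now apply IH].
  intros x hx. apply (is_derive_plus f g); auto.
Qed.

Lemma differentiable_upto_mult (c : R) (n : nat) (f g : R -> R) :
  differentiable_upto c n f -> differentiable_upto c n g ->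
  differentiable_upto c n (fun x => f x * g x).
Proof.
  revert f g. induction n as [|n IH]; [easy|].
  intros f g hf hg.
  pose proof (differentiable_upto_pred _ _ _ hf) as hfn.
  pose proof (differentiable_upto_pred _ _ _ hg) as hgn.
  destruct hf as (f' & hf & hf'). destruct hg as (g' & hg & hg').
  exists (fun x => f' x * g x + f x * g' x). split.
  - intros x hx. apply (is_derive_mult f g); [auto|auto|]. intros; apply Rmult_comm.
  - apply differentiable_upto_plus; now apply IH.
Qed.

Lemma differentiable_upto_exp (c : R) (n : nat) (f : R -> R) :
  differentiable_upto c n f -> differentiable_upto c n (fun x => exp (f x)).
Proof.
  induction n as [|n IH]; [easy|]. intros hf.
  pose proof (differentiable_upto_pred _ _ _ hf) as hfn.
  destruct hf as (f' & hf & hf').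
  exists (fun x => f' x * exp (f x)). split.
  - intros x hx. apply (is_derive_comp exp f); [apply is_derive_exp|auto].
  - apply differentiable_upto_mult; [exact hf'|now apply IH].
Qed.

Lemma differentiable_upto_chain (c : R) (g : nat -> R -> R) :
  (forall k x, c < x -> is_derive (g k) x (g (S k) x)) ->
  forall n k, differentiable_upto c n (g k).
Proof.
  intros hg. induction n as [|n IH]; intros k; [exact I|].
  exists (g (S k)). split; auto.
Qed.

Lemma differentiable_upto_ex_derive_n (c : R) (n : nat) (f : R -> R) :
  differentiable_upto c n f -> forall x, c < x -> ex_derive_n f n x.
Proof.
  revert f. induction n as [|n IH]; [easy|].
  intros f (f' & hf & hf') x hx.
  assert (hloc : locally x (fun t => c < t)) by now apply (open_gt c).
  assert (E : forall m t, c < t -> Derive_n f (S m) t = Derive_n f' m t).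
  { intros m t ht. rewrite <- Nat.add_1_r, <- Derive_n_comp.
    apply Derive_n_ext_loc.
    apply (filter_imp (fun u => c < u)); [|now apply (open_gt c)].
    intros u hu. now apply is_derive_unique, hf. }
  destruct n as [|m].
  - exists (f' x). now apply hf.
  - specialize (IH f' hf' x hx). simpl in IH |- *.
    apply (ex_derive_ext_loc (Derive_n f' m)); [|exact IH].
    revert hloc. apply filter_imp. intros t ht. symmetry. now apply E.
Qed.

(** Given a sequence of functions, each the derivative of the preceding one and
    starting with [ln f], only the signs remain to be examined: [f] itself is smooth
    as the exponential of the first of them. *)
Lemma log_completely_monotonic_iff (c : R) (f : R -> R) (g : nat -> R -> R) :
  (forall k x, c < x -> is_derive (g k) x (g (S k) x)) ->
  (forall x, c < x -> 0 < f x) ->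
  (forall x, c < x -> ln (f x) = g O x) ->
  log_completely_monotonic c p_infty f <->
  (forall k x, (1 <= k)%nat -> c < x -> 0 <= (-1) ^ k * g k x).
Proof.
  intros hg hpos hln.
  pose proof (derivative_chain c (fun t => ln (f t)) g hg hln) as hch.
  split.
  - intros (_ & _ & H) k x hk hx.
    destruct (hch k x hx) as [_ <-]. now apply H.
  - intros H. split; [|split].
    + intros x hx _. now apply hpos.
    + intros k x hx _.
      assert (hx' : c < x) by exact hx.
      apply (ex_derive_n_ext_loc (fun t => exp (g O t))).
      * apply (filter_imp (fun t => c < t)); [|now apply (open_gt c)].
        intros t ht. rewrite <- hln by exact ht. now apply exp_ln, hpos.
      * apply (differentiable_upto_ex_derive_n c); [|exact hx'].
        now apply differentiable_upto_exp, differentiable_upto_chain.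
    + intros k x hk hx _. destruct (hch k x hx) as [h1 h2].
      split; [exact h1|]. rewrite h2. now apply H.
Qed.

Lemma log_completely_monotonic_h (alpha y : R) :
  -1 < y ->
  log_completely_monotonic (Finite (- y - 1)) p_infty (h alpha y) <->
  (forall k x, (1 <= k)%nat -> - y - 1 < x ->
     0 <= (-1) ^ k * ln_h_derivative k (y + 1) alpha x).
Proof.
  intros hy. apply log_completely_monotonic_iff.
  - intros k x hx. apply is_derive_ln_h_derivative; lra.
  - intros x _. apply h_pos.
  - intros x hx. now apply ln_h.
Qed.

Lemma log_completely_monotonic_inv_h (alpha y : R) :
  -1 < y ->
  log_completely_monotonic (Finite (- y - 1)) p_infty (fun x => 1 / h alpha y x) <->
  (forall k x, (1 <= k)%nat -> - y - 1 < x ->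
     (-1) ^ k * ln_h_derivative k (y + 1) alpha x <= 0).
Proof.
  intros hy.
  rewrite (log_completely_monotonic_iff (- y - 1) _
             (fun k x => - ln_h_derivative k (y + 1) alpha x)).
  - split; intros H k x hk hx; specialize (H k x hk hx); lra.
  - intros k x hx.
    apply (is_derive_opp (ln_h_derivative k (y + 1) alpha)).
    apply is_derive_ln_h_derivative; lra.
  - intros x _. apply Rdiv_lt_0_compat; [lra|apply h_pos].
  - intros x hx. rewrite ln_div, ln_1, ln_h by (lra || apply h_pos). ring.
Qed.

(** * Sufficient conditions *)

(** By [is_RInt_power_tail] both sides are integrals over [[0, 1]], of
    [s^k (alpha / (k z^k) + alpha a / z^(k+1))] and of [s^k zeta (k+1, z)]. The
    conditions on [alpha] and [alpha a] compare the coefficients of the first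
    integrand with those of the two bounds on [zeta (k+1, z)]. *)
Lemma moment_hurwitz_bounds (k : nat) (a alpha x : R) :
  (1 <= k)%nat -> 0 < a -> - a < x ->
  (1 <= alpha /\ 1 <= alpha * a ->
     moment k (hurwitz (S k)) a x <= alpha / (INR k * (x + a) ^ k)) /\
  (alpha <= 1 /\ alpha * a <= 1 / 2 ->
     alpha / (INR k * (x + a) ^ k) <= moment k (hurwitz (S k)) a x).
Proof.
  intros hk ha hx.
  assert (hI : is_RInt (fun s => s ^ k * (alpha * power_tail a k (a + x * s))) 0 1
                 (alpha / (INR k * (x + a) ^ k))).
  { apply (is_RInt_ext (fun s => scal alpha (s ^ k * power_tail a k (a + x * s)))).
    - intros s _. unfold scal; simpl. unfold mult; simpl. ring.
    - apply (@is_RInt_scal R_NormedModule). now apply is_RInt_power_tail. }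
  pose proof (is_RInt_moment k (hurwitz (S k)) a x
    (fun t ht => continuous_hurwitz k t hk ht) ha hx) as hM.
  assert (hk' : 0 < INR k) by (apply lt_0_INR; lia).
  assert (hz : forall s, 0 < s < 1 -> 0 < a + x * s /\
     0 < / (INR k * (a + x * s) ^ k) /\ 0 < / (a + x * s) ^ S k).
  { intros s hs. assert (0 < a + x * s) by (apply segment_pos; lra).
    split; [assumption|].
    split; apply Rinv_0_lt_compat; [apply Rmult_lt_0_compat; [exact hk'|]|];
      now apply pow_lt. }
  split; intros [h1 h2].
  - eapply is_RInt_le; [|exact hM|exact hI|]; [lra|].
    intros s hs. destruct (hz s hs) as (hz0 & hz1 & hz2).
    apply Rmult_le_compat_l; [apply pow_le; lra|].
    eapply Rle_trans; [now apply hurwitz_bounds|].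
    unfold power_tail, Rdiv. nra.
  - eapply is_RInt_le; [|exact hI|exact hM|]; [lra|].
    intros s hs. destruct (hz s hs) as (hz0 & hz1 & hz2).
    apply Rmult_le_compat_l; [apply pow_le; lra|].
    eapply Rle_trans; [|now apply hurwitz_bounds].
    unfold power_tail, Rdiv. nra.
Qed.

(** * Necessary conditions *)

(** Closed form of [int_0^1 s / (a + x s) ds] for nonzero [x]. *)
Definition inv_moment (a x : R) : R := (1 - a / x * ln ((x + a) / a)) / x.

Lemma is_RInt_inv_moment (a x : R) :
  0 < a -> - a < x -> x <> 0 ->
  is_RInt (fun s => s / (a + x * s)) 0 1 (inv_moment a x).
Proof.
  intros ha hx hx0.
  set (P := fun s => s / x - a / x ^ 2 * ln (a + x * s)).
  replace (inv_moment a x) with (minus (P 1) (P 0)).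
  2:{ unfold P, inv_moment, minus, plus, opp; simpl.
      replace (a + x * 1) with (x + a) by ring. replace (a + x * 0) with a by ring.
      rewrite ln_div by lra. field. exact hx0. }
  apply (is_RInt_derive P (fun s => s / (a + x * s)));
    rewrite Rmin_left, Rmax_right by lra; intros s hs;
    pose proof (segment_pos a x s ha hx hs) as hp.
  - unfold P. auto_derive; [exact hp|]. field. lra.
  - apply (ex_derive_continuous (fun s => s / (a + x * s))).
    auto_derive. lra.
Qed.

(** Here [L] and [T] are the integrals of [s / z] and [s / z^2] with
    [z = a + x s]; the value of [T] follows from [is_RInt_power_tail], which gives
    [L + a T = 1 / (x + a)]. The three inequalities integrate [1/z <= zeta (2, z)],
    [1/z^2 <= zeta (2, z)] and [zeta (2, z) <= 1/z + 1/z^2]. *)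
Lemma moment_hurwitz2_bounds (a x : R) :
  0 < a -> - a < x -> x <> 0 ->
  let L := inv_moment a x in
  let T := (/ (x + a) - L) / a in
  L <= moment 1 (hurwitz 2) a x /\
  T <= moment 1 (hurwitz 2) a x <= L + T.
Proof.
  intros ha hx hx0 L T.
  pose proof (is_RInt_inv_moment a x ha hx hx0) as hL. fold L in hL.
  assert (hT : is_RInt (fun s => s / (a + x * s) ^ 2) 0 1 T).
  { pose proof (is_RInt_power_tail 1 a x (le_n 1) ha hx) as hP.
    pose proof (is_RInt_scal _ _ _ (/ a) _ (is_RInt_minus _ _ _ _ _ _ hP hL)) as h.
    replace T with (scal (/ a) (minus (/ (INR 1 * (x + a) ^ 1)) L)).
    - eapply is_RInt_ext; [|exact h]. intros s hs.
      rewrite Rmin_left, Rmax_right in hs by lra.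
      pose proof (segment_pos a x s ha hx ltac:(lra)).
      unfold power_tail, scal, minus, plus, opp; simpl. unfold mult; simpl.
      field. lra.
    - unfold T, scal, minus, plus, opp; simpl. unfold mult; simpl. field. lra. }
  pose proof (is_RInt_moment 1 (hurwitz 2) a x
    (fun t ht => continuous_hurwitz 1 t (le_n 1) ht) ha hx) as hM.
  assert (hz : forall s, 0 < s < 1 ->
    0 < a + x * s /\ / (a + x * s) <= hurwitz 2 (a + x * s) /\
    / (a + x * s) ^ 2 <= hurwitz 2 (a + x * s)
    <= / (a + x * s) + / (a + x * s) ^ 2).
  { intros s hs. assert (hp : 0 < a + x * s) by (apply segment_pos; lra).
    split; [exact hp|].
    pose proof (hurwitz_bounds 1 _ (le_n 1) hp) as hb.
    rewrite (hurwitz_shift 1) in * by (lia || exact hp).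
    pose proof (hurwitz2_pos (a + x * s + 1) ltac:(lra)).
    assert (0 < / (a + x * s) ^ 2) by (apply Rinv_0_lt_compat, pow_lt, hp).
    unfold power_tail, Rdiv in hb. simpl INR in hb. rewrite !Rmult_1_l, pow_1 in hb.
    repeat split; lra. }
  split; [|split].
  - eapply is_RInt_le; [|exact hL|exact hM|]; [lra|].
    intros s hs. destruct (hz s hs) as (hp & h1 & h2). rewrite pow_1.
    apply Rmult_le_compat_l; [lra|exact h1].
  - eapply is_RInt_le; [|exact hT|exact hM|]; [lra|].
    intros s hs. destruct (hz s hs) as (hp & h1 & h2). rewrite pow_1.
    apply Rmult_le_compat_l; [lra|apply h2].
  - eapply is_RInt_le; [|exact hM|exact (is_RInt_plus _ _ _ _ _ _ hL hT)|]; [lra|].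
    intros s hs. destruct (hz s hs) as (hp & h1 & h2). rewrite pow_1.
    unfold plus; simpl. unfold Rdiv. rewrite <- Rmult_plus_distr_l.
    apply Rmult_le_compat_l; [lra|apply h2].
Qed.

Lemma ln_le_sub_1_INR (n : nat) :
  0 <= ln (INR n + 1) <= INR n.
Proof.
  pose proof (pos_INR n). split.
  - rewrite <- ln_1. apply ln_le; lra.
  - pose proof (ln_le_sub_1 (INR n + 1) ltac:(lra)). lra.
Qed.

(** With [L = inv_moment a x] and [X = x + a], the product [X L] tends to [1] as
    [X] tends to infinity. Taking [X / a] to be the square of
    [m + 1], with [m = INR n], makes the elementary bound [ln (m + 1) <= m] strong
    enough, because [ln (X / a) = 2 ln (m + 1)] while [X / a] is quadratic in
    [m]. *)
Lemma inv_moment_at_infinity (a : R) (n : nat) :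
  0 < a -> (1 <= n)%nat ->
  let X := a * (INR n + 1) ^ 2 in
  Rabs (X * inv_moment a (X - a) - 1) <= 2 / INR n.
Proof.
  intros ha hn X.
  assert (hn' : 1 <= INR n) by now apply (le_INR 1).
  pose proof (ln_le_sub_1_INR n) as hw.
  set (m := INR n) in *. set (w := ln (m + 1)) in *.
  assert (E : X * inv_moment a (X - a) - 1
              = (1 - 2 * (m + 1) ^ 2 * w / (m * (m + 2))) / (m * (m + 2))).
  { unfold inv_moment. replace (X - a + a) with X by ring.
    replace (X / a) with ((m + 1) ^ 2) by (unfold X; field; lra).
    rewrite ln_pow by lra. fold w. unfold X. simpl INR. field.
    split; [nra|]. split; [lra|]. nra. }
  rewrite E.
  assert (hd : 0 < m * (m + 2)) by nra.
  assert (h1 : 0 <= 2 * (m + 1) ^ 2 * w / (m * (m + 2)) <= 2 * (m + 1) ^ 2 / (m + 2)).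
  { split.
    - apply Rdiv_le_0_compat; [|exact hd].
      apply Rmult_le_pos; [|lra]. pose proof (pow2_ge_0 (m + 1)). lra.
    - replace (2 * (m + 1) ^ 2 / (m + 2)) with (2 * (m + 1) ^ 2 * m / (m * (m + 2)))
        by (field; lra).
      apply Rmult_le_compat_r; [apply Rlt_le, Rinv_0_lt_compat, hd|].
      apply Rmult_le_compat_l; [|lra]. pose proof (pow2_ge_0 (m + 1)). lra. }
  apply Rabs_le. split.
  - apply (proj1 (Rle_div_r _ _ _ hd)).
    replace (- (2 / m) * (m * (m + 2))) with (- (2 * (m + 2))) by (field; lra).
    assert (2 * (m + 1) ^ 2 / (m + 2) <= 2 * (m + 2) + 1); [|lra].
    assert (hm2 : m + 2 > 0) by lra.
    apply (proj2 (Rle_div_l _ _ _ hm2)). nra.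
  - apply (proj2 (Rle_div_l _ _ _ hd)).
    replace (2 / m * (m * (m + 2))) with (2 * (m + 2)) by (field; lra). lra.
Qed.

(** In the same notation [X L] tends to [0] as [X] tends to [0]; a square is chosen for [a / X] for the
    same reason as in [inv_moment_at_infinity]. *)
Lemma inv_moment_at_0 (a : R) (n : nat) :
  0 < a -> (1 <= n)%nat ->
  let X := a / (INR n + 1) ^ 2 in
  X * inv_moment a (X - a) <= 2 / INR n.
Proof.
  intros ha hn X.
  assert (hn' : 1 <= INR n) by now apply (le_INR 1).
  pose proof (ln_le_sub_1_INR n) as hw.
  set (m := INR n) in *. set (w := ln (m + 1)) in *.
  assert (E : X * inv_moment a (X - a)
              = (2 * (m + 1) ^ 2 * w / (m * (m + 2)) - 1) / (m * (m + 2))).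
  { unfold inv_moment. replace (X - a + a) with X by ring.
    replace (X / a) with (/ (m + 1) ^ 2) by (unfold X; field; lra).
    rewrite ln_Rinv, ln_pow by (try apply pow_lt; lra). fold w. unfold X. simpl INR.
    field. repeat split; nra. }
  rewrite E.
  assert (hd : 0 < m * (m + 2)) by nra.
  assert (h1 : 2 * (m + 1) ^ 2 * w / (m * (m + 2)) <= 2 * (m + 1) ^ 2 / (m + 2)).
  { replace (2 * (m + 1) ^ 2 / (m + 2)) with (2 * (m + 1) ^ 2 * m / (m * (m + 2)))
      by (field; lra).
    apply Rmult_le_compat_r; [apply Rlt_le, Rinv_0_lt_compat, hd|].
    apply Rmult_le_compat_l; [|lra]. pose proof (pow2_ge_0 (m + 1)). lra. }
  apply (proj2 (Rle_div_l _ _ _ hd)).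
  replace (2 / m * (m * (m + 2))) with (2 * (m + 2)) by (field; lra).
  assert (2 * (m + 1) ^ 2 / (m + 2) <= 2 * (m + 2)); [|lra].
  assert (hm2 : m + 2 > 0) by lra.
  apply (proj2 (Rle_div_l _ _ _ hm2)). nra.
Qed.

(** With [L] and [T] as in [moment_hurwitz2_bounds] and [X = x + a]: letting [X]
    tend to infinity in [L <= alpha / X] gives [1 <= alpha]; letting [X]
    tend to [0] in [T <= alpha / X], that is [1 - X L <= alpha a], gives
    [1 <= alpha a]. *)
Lemma ge_of_first_moment_bound (a alpha : R) :
  0 < a ->
  (forall x, - a < x -> moment 1 (hurwitz 2) a x <= alpha / (x + a)) ->
  1 <= alpha /\ 1 <= alpha * a.
Proof.
  intros ha H. split.
  - assert (1 - alpha <= 0); [|lra].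
    apply (le_inv_INR_0 _ 2). intros n hn.
    pose proof (inv_moment_at_infinity a n ha hn) as hb. cbv zeta in hb.
    assert (hn' : 1 <= INR n) by now apply (le_INR 1).
    set (X := a * (INR n + 1) ^ 2) in *.
    assert (hX : a < X) by (unfold X; nra).
    destruct (moment_hurwitz2_bounds a (X - a) ha ltac:(lra) ltac:(lra)) as (h1 & _).
    specialize (H (X - a) ltac:(lra)).
    replace (X - a + a) with X in H by ring.
    assert (h2 : inv_moment a (X - a) <= alpha / X) by lra.
    apply (proj2 (Rle_div_r (inv_moment a (X - a)) alpha X ltac:(lra))) in h2.
    apply Rabs_le_between in hb. lra.
  - assert (1 - alpha * a <= 0); [|lra].
    apply (le_inv_INR_0 _ 2). intros n hn.
    pose proof (inv_moment_at_0 a n ha hn) as hb. cbv zeta in hb.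
    assert (hn' : 1 <= INR n) by now apply (le_INR 1).
    set (X := a / (INR n + 1) ^ 2) in *.
    assert (hX : 0 < X < a).
    { assert (0 < (INR n + 1) ^ 2) by (apply pow_lt; lra).
      unfold X. split; [now apply Rdiv_lt_0_compat|].
      apply (proj2 (Rlt_div_l a a ((INR n + 1) ^ 2) ltac:(lra))). nra. }
    destruct (moment_hurwitz2_bounds a (X - a) ha ltac:(lra) ltac:(lra)) as (_ & h1 & _).
    specialize (H (X - a) ltac:(lra)).
    replace (X - a + a) with X in * by ring.
    assert (h2 : (/ X - inv_moment a (X - a)) / a <= alpha / X) by lra.
    apply (Rmult_le_compat_l (X * a)) in h2; [|nra].
    replace (X * a * ((/ X - inv_moment a (X - a)) / a))
      with (1 - X * inv_moment a (X - a)) in h2 by (field; lra).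
    replace (X * a * (alpha / X)) with (alpha * a) in h2 by (field; lra).
    lra.
Qed.

(** In the same notation, from [alpha / X <= L + T] one gets [alpha - 1 <= (X L - 1) (1 - 1/a)], whose
    right-hand side tends to [0] as [X] tends to infinity, whatever its sign. *)
Lemma le_of_first_moment_bound (a alpha : R) :
  0 < a ->
  (forall x, - a < x -> alpha / (x + a) <= moment 1 (hurwitz 2) a x) ->
  alpha <= 1.
Proof.
  intros ha H.
  assert (alpha - 1 <= 0); [|lra].
  apply (le_inv_INR_0 _ (2 * Rabs (1 - / a))). intros n hn.
  pose proof (inv_moment_at_infinity a n ha hn) as hb. cbv zeta in hb.
  assert (hn' : 1 <= INR n) by now apply (le_INR 1).
  set (X := a * (INR n + 1) ^ 2) in *.
  assert (hX : a < X) by (unfold X; nra).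
  destruct (moment_hurwitz2_bounds a (X - a) ha ltac:(lra) ltac:(lra)) as (_ & _ & h1).
  specialize (H (X - a) ltac:(lra)).
  replace (X - a + a) with X in * by ring.
  set (L := inv_moment a (X - a)) in *.
  assert (h2 : alpha / X <= L + (/ X - L) / a) by lra.
  apply (Rmult_le_compat_l X) in h2; [|lra].
  replace (X * (alpha / X)) with alpha in h2 by (field; lra).
  replace (X * (L + (/ X - L) / a)) with (1 + (X * L - 1) * (1 - / a)) in h2
    by (field; lra).
  pose proof (Rle_abs ((X * L - 1) * (1 - / a))) as h3.
  rewrite Rabs_mult in h3.
  replace (2 * Rabs (1 - / a) / INR n) with (2 / INR n * Rabs (1 - / a)) by (field; lra).
  pose proof (Rmult_le_compat_r _ _ _ (Rabs_pos (1 - / a)) hb). lra.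
Qed.

Lemma ge_Rmax_iff (a alpha : R) :
  0 < a -> alpha >= Rmax 1 (1 / a) <-> 1 <= alpha /\ 1 <= alpha * a.
Proof.
  intros ha. rewrite <- (Rle_div_l 1 alpha a ha).
  split.
  - intros h. pose proof (Rmax_l 1 (1 / a)). pose proof (Rmax_r 1 (1 / a)). lra.
  - intros [h1 h2]. apply Rle_ge. now apply Rmax_lub.
Qed.

(** * The three statements *)

Theorem theorem1 (y alpha : R) (hy : -1 < y) :
  (log_completely_monotonic (Finite (- y - 1)) p_infty (h alpha y) <->
     alpha >= Rmax 1 (1 / (y + 1))) /\
  (alpha <= Rmin 1 (1 / (2 * (y + 1))) ->
     log_completely_monotonic (Finite (- y - 1)) p_infty
       (fun x : R => 1 / h alpha y x)) /\
  (log_completely_monotonic (Finite (- y - 1)) p_infty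
       (fun x : R => 1 / h alpha y x) ->
     alpha <= 1).
Proof.
  rewrite log_completely_monotonic_h, log_completely_monotonic_inv_h by exact hy.
  assert (ha : 0 < y + 1) by lra.
  rewrite ge_Rmax_iff by exact ha.
  set (a := y + 1) in *.
  assert (hfact : forall k, 0 < INR (fact k)) by (intros; apply INR_fact_lt_0).
  assert (hD : forall x, - y - 1 < x -> - a < x) by (unfold a; intros; lra).
  split; [split|split].
  - intros H. apply (ge_of_first_moment_bound a alpha ha). intros x hx.
    specialize (H 1%nat x (le_n 1) ltac:(unfold a in hx; lra)).
    rewrite signed_ln_h_derivative in H by (lia || assumption).
    simpl in H. rewrite !Rmult_1_l, Rmult_1_r in H. lra.
  - intros hal k x hk hx. apply hD in hx.
    rewrite signed_ln_h_derivative by assumption.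
    apply Rmult_le_pos; [apply Rlt_le, hfact|].
    pose proof (proj1 (moment_hurwitz_bounds k a alpha x hk ha hx) hal). lra.
  - intros hal k x hk hx. apply hD in hx.
    rewrite signed_ln_h_derivative by assumption.
    assert (hal' : alpha <= 1 /\ alpha * a <= 1 / 2).
    { pose proof (Rmin_l 1 (1 / (2 * a))). pose proof (Rmin_r 1 (1 / (2 * a))).
      split; [lra|]. apply (proj2 (Rle_div_r alpha (1 / 2) a ha)).
      replace (1 / 2 / a) with (1 / (2 * a)) by (field; lra). lra. }
    pose proof (proj2 (moment_hurwitz_bounds k a alpha x hk ha hx) hal').
    pose proof (hfact k). nra.
  - intros H. apply (le_of_first_moment_bound a alpha ha). intros x hx.
    specialize (H 1%nat x (le_n 1) ltac:(unfold a in hx; lra)).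
    rewrite signed_ln_h_derivative in H by (lia || assumption).
    simpl in H. rewrite !Rmult_1_l, Rmult_1_r in H. lra.
Qed.
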